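(* Let $1<p<\infty$, let $Y$ be a Banach function space over $\mathbb{R}^n$ with Lebesgue measure, let $S$ be a sparse family of dyadic cubes in $\mathbb{R}^n$, and let $T^S$ be the associated sparse operator. Let $(w,v)$ be a pair of weights on $\mathbb{R}^n$ such that, for some $q$ with $p<q<\infty$ and some constant $K<\infty$, $$\|w\|_{q,Q}\,\|v^{-1}\|_{Y,Q}\le K\qquad\text{for all }Q\in S.$$ Then there is a constant $C$, not depending on $f$, such that for every nonnegative locally integrable function $f$ on $\mathbb{R}^n$, $$\int_{\mathbb{R}^n}\big(T^Sf(y)\,w(y)\big)^p\,dy\le C^p\int_{\mathbb{R}^n}\big(M_{Y'}(fv)(y)\big)^p\,dy .$$
   Context: A weight is a locally integrable function on $\mathbb{R}^n$ that is positive almost everywhere. $|E|$ is Lebesgue measure, cubes have sides parallel to the axes, $\ell(Q)$ is the side length of $Q$, $⨍_Q f=\frac1{|Q|}\int_Q f$, and $\|f\|_{q,Q}=\left(\frac1{|Q|}\int_Q|f|^q\right)^{1/q}$. Sparse families and operators: fix a dyadic grid $\mathscr{D}=\bigcup_k\mathscr{D}_k$ in $\mathbb{R}^n$ (each $\mathscr D_k$ is a partition of $\mathbb{R}^n$ into half-open cubes of side $2^{-k}$, and any two cubes of $\mathscr D$ are nested or disjoint). A family $S\subset\mathscr{D}$ is sparse if for every $Q\in S$, $\left|\bigcup_{Q'\in S,\,Q'\subsetneq Q}Q'\right|\le\frac{|Q|}{2}$. The sparse operator is $T^Sf=\sum_{Q\in S}\left(\frac1{|Q|}\int_Qf\right)\chi_Q$.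 Banach function spaces: $Y$ is a Banach function space over $(\mathbb{R}^n,dx)$ in the usual (Bennett–Sharpley) sense, and $Y'$ is its associate space, with norm $\|f\|_{Y'}=\sup\{\int_{\mathbb{R}^n}|fg|\,dx:\|g\|_Y\le1\}$. For a cube $Q$, the average of $f$ over $Q$ in a Banach function space $Z$ (here $Z=Y$ or $Y'$) is $\|f\|_{Z,Q}=\|\delta_{\ell(Q)}(f\chi_Q)\|_Z$, where $\delta_rf(x)=f(rx)$; thus for $Z=L^p$ it is $\|f\|_{p,Q}$, and for an Orlicz space $Z=L^B$ with its Luxemburg norm it is the Orlicz average $\|f\|_{B,Q}=\inf\{\lambda>0:\frac1{|Q|}\int_QB(|f|/\lambda)\,dx\le1\}$. The associated maximal function is $M_{Y'}f(x)=\sup_{Q\ni x}\|f\|_{Y',Q}$, the supremum being over all cubes $Q$ containing $x$. *)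

(* Defs.v *)
From HB Require Import structures.
From mathcomp Require Import all_boot all_order all_algebra.
From mathcomp Require Import all_classical all_reals all_analysis.
From mathcomp Require Import measurable_realfun.

Set Implicit Arguments.
Unset Strict Implicit.
Unset Printing Implicit Defensive.
Import Order.TTheory GRing.Theory Num.Theory.
Import numFieldNormedType.Exports.

Local Open Scope classical_set_scope.
Local Open Scope ring_scope.

(* The dimension is written n.+1 throughout, i.e., it is at least 1. *)

Definition box (R : realType) (n : nat) (ab : 'rV[R]_n.+1 * 'rV[R]_n.+1) :
    set 'rV[R]_n.+1 :=
  [set x | forall i, ab.1 ord0 i <= x ord0 i < ab.2 ord0 i].

Definition box_vol (R : realType) (n : nat)
    (ab : 'rV[R]_n.+1 * 'rV[R]_n.+1) : R :=
  \prod_(i < n.+1) Num.max 0 (ab.2 ord0 i - ab.1 ord0 i).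

(* Lebesgue outer measure: infimum of the total volume of countable covers
   by half-open boxes (possibly empty). *)
Definition lebesgue_outer (R : realType) (n : nat)
    (A : set 'rV[R]_n.+1) : \bar R :=
  ereal_inf [set (\sum_(k <oo) (box_vol (C k))%:E)%E | C in
    [set C : nat -> 'rV[R]_n.+1 * 'rV[R]_n.+1 | A `<=` \bigcup_k box (C k)]].

Section lebesgue_outer_measure.
Variables (R : realType) (n : nat).
Local Open Scope ereal_scope.
Local Notation V := 'rV[R]_n.+1.
Local Notation lo := (@lebesgue_outer R n).

Lemma box_vol_ge0 (ab : V * V) : 0 <= (box_vol ab)%:E.
Proof.
by rewrite lee_fin; apply: prodr_ge0 => i _; rewrite le_max lexx.
Qed.

Lemma lebesgue_outer_ge0 (A : set V) : 0 <= lo A.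
Proof.
apply: le_ereal_inf_tmp => _ [C _ <-].
by apply: nneseries_ge0 => k _ _; exact: box_vol_ge0.
Qed.

Lemma lebesgue_outer0 : lo set0 = 0.
Proof.
apply/eqP; rewrite eq_le lebesgue_outer_ge0 andbT.
apply: ereal_inf_lbound; exists (fun=> (0%R, 0%R)); first exact: sub0set.
apply: eseries0 => k _ _.
by rewrite /box_vol big_ord_recl /= subrr maxxx mul0r.
Qed.

Lemma lebesgue_outer_subset_sigma_subadditive (A : set V) (F : (set V)^nat) :
  A `<=` \bigcup_k F k -> lo A <= \sum_(k <oo) lo (F k).
Proof.
move=> AF; have [[i ioo]|] := pselect (exists i, lo (F i) = +oo).
  rewrite (eseries_pinfty _ _ ioo) ?leey// => k _.
  by rewrite -ltNye (lt_le_trans _ (lebesgue_outer_ge0 _)).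
rewrite -forallNE => Foo.
apply/lee_addgt0Pr => _/posnumP[e].
rewrite (le_trans _ (epsilon_trick _ _ _))//; last first.
  by move=> k; exact: lebesgue_outer_ge0.
pose P k (C : nat -> V * V) := F k `<=` \bigcup_j box (C j) /\
  \sum_(j <oo) (box_vol (C j))%:E <=
    lo (F k) + (e%:num / (2 ^ k.+1)%:R)%:E.
have [G PG] : {G : nat -> nat -> V * V & forall k, P k (G k)}.
  apply: (@choice _ _ P) => k; rewrite /P.
  have ek : (0 < e%:num / (2 ^ k.+1)%:R :> R)%R by [].
  have fk : lo (F k) \is a fin_num.
    by rewrite ge0_fin_numE ?lebesgue_outer_ge0// ltey; exact/eqP/Foo.
  have [_ [C FC <-] xS] := lb_ereal_inf_adherent ek fk.
  by exists C; split => //; exact/ltW.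
pose g := (fun ab => (box_vol ab)%:E) \o uncurry G.
have g_ge0 x : 0 <= g x by exact: box_vol_ge0.
apply: (@le_trans _ _ (\esum_(i in setT) g i)).
  apply: ereal_inf_lbound => /=.
  have /card_esym/ppcard_eqP[f] := card_nat2.
  exists (uncurry G \o f).
    apply: (subset_trans AF) => t [i _ /(PG i).1[j _ Gt]].
    by exists (f^-1%FUN (i, j)) => //=; rewrite invK ?inE.
  rewrite -(esum_pred_image g _ xpredT) ?[fun=> _]set_true//.
  by rewrite image_eq.
rewrite (_ : esum _ _ = \sum_(i <oo) \sum_(j <oo) (box_vol (G i j))%:E);
    last first.
  pose J : nat -> set (nat * nat) := fun i => [set (i, j) | j in setT].
  rewrite (_ : setT = \bigcup_k J k); last first.
    by rewrite predeqE => -[a b]; split => // _; exists a => //; exists b.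
  rewrite esum_bigcupT /=; last 2 first.
    - apply/trivIsetP => i j _ _ ij.
      rewrite predeqE => -[k m] /=; split => //= -[] [_] _ [<-{k} _].
      by move=> [m' _] [] /esym/eqP; rewrite (negbTE ij).
    - by move=> k; exact: g_ge0.
  rewrite -(image_id [set: nat]) -fun_true esum_pred_image//; last first.
    by move=> k _; exact: esum_ge0.
  apply: eq_eseriesr => /= j _.
  rewrite -(esum_pred_image g (pair j) predT)//=; last first.
    by move=> ? ? _ _; exact: (@can_inj _ _ _ snd).
  by congr esum; rewrite predeqE => -[a b]; split; move=> [i _ <-]; exists i.
apply: lee_nneseries => k _; last exact: (PG k).2.
by move=> _; apply: nneseries_ge0 => j _ _; exact: box_vol_ge0.
Qed.

HB.instance Definition _ := isSubsetOuterMeasure.Build R V lo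
  lebesgue_outer0 lebesgue_outer_ge0 lebesgue_outer_subset_sigma_subadditive.

End lebesgue_outer_measure.

(* R^(n+1) with its Lebesgue (i.e., Caratheodory-measurable) sigma-algebra. *)
Notation Rn R n := (caratheodory_type (@lebesgue_outer R n)).

Definition leb (R : realType) (n : nat) : set (Rn R n) -> \bar R :=
  @lebesgue_outer R n.

HB.instance Definition _ (R : realType) (n : nat) :=
  isMeasure.Build _ _ _ (@leb R n)
    (@caratheodory_measure0 _ _ (@lebesgue_outer R n))
    (@caratheodory_measure_ge0 _ _ (@lebesgue_outer R n))
    (@caratheodory_measure_sigma_additive _ _ (@lebesgue_outer R n)).

Section definitions.
Variables (R : realType) (n : nat).
Local Notation Rn := (Rn R n).
Local Notation leb := (@leb R n).

(* A cube is given by its lower corner and its side length, and it is half-open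
   everywhere, also in the maximal function. With closed cubes the maximal
   function would be pointwise at least as large, since the averages only
   depend on Q up to a null set. *)
Definition cube : Type := (Rn * {posnum R})%type.
HB.instance Definition _ := Choice.on cube.

Definition side (Q : cube) : R := Q.2%:num.

Definition cset (Q : cube) : set Rn := box (Q.1, Q.1 + const_mx (side Q)).

Definition loc_integrable (f : Rn -> R) : Prop :=
  measurable_fun [set: Rn] f /\
  forall K : set 'rV[R]_n.+1, compact K ->
    (\int[leb]_(x in K) `|f x|%:E < +oo)%E.

Definition weight (w : Rn -> R) : Prop :=
  loc_integrable w /\ {ae leb, forall x, 0 < w x}.

Local Open Scope ereal_scope.

Definition average (Q : cube) (f : Rn -> \bar R) : \bar R :=
  (leb (cset Q))^-1 * \int[leb]_(x in cset Q) f x.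

Definition Lp_average (q : R) (Q : cube) (f : Rn -> \bar R) : \bar R :=
  (average Q (fun x => `|f x| `^ q)) `^ q^-1.

Definition dyadic_grid (D : int -> set cube) : Prop :=
  [/\ forall k Q, D k Q -> side Q = (2 ^ (- k))%R,
      forall k, partition (D k) cset [set: Rn] &
      forall k l Q Q', D k Q -> D l Q' ->
        [\/ cset Q `<=` cset Q', cset Q' `<=` cset Q |
            cset Q `&` cset Q' = set0]].

Definition sparse (D : int -> set cube) (S : set cube) : Prop :=
  S `<=` \bigcup_k D k /\
  forall Q, S Q ->
    leb (\bigcup_(Q' in [set Q' | S Q' /\ cset Q' `<` cset Q]) cset Q') <=
    (2^-1)%:E * leb (cset Q).

(* The sum is a supremum of finite partial sums, hence meaningful for
   nonnegative f only. *)
Definition sparse_op (S : set cube) (f : Rn -> R) (x : Rn) : \bar R :=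
  \esum_(Q in S) (average Q (EFin \o f) * (\1_(cset Q) x)%:E).

Definition nonneg_measurable (f : Rn -> \bar R) : Prop :=
  measurable_fun [set: Rn] f /\ forall x, 0 <= f x.

(* Function norms in the sense of Bennett and Sharpley, axioms (P1)-(P5). The
   value of rho is constrained on nonnegative measurable functions only. *)
Record function_norm (rho : (Rn -> \bar R) -> \bar R) : Prop := FunctionNorm {
  fnorm_ge0 : forall f, nonneg_measurable f -> 0 <= rho f ;
  fnorm_eq0 : forall f, nonneg_measurable f ->
    (rho f = 0 <-> {ae leb, forall x, f x = 0}) ;
  fnormZ : forall (a : R) f, (0 <= a)%R -> nonneg_measurable f ->
    rho (fun x => a%:E * f x) = a%:E * rho f ;
  fnormD : forall f g, nonneg_measurable f -> nonneg_measurable g ->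
    rho (f \+ g) <= rho f + rho g ;
  le_fnorm : forall f g, nonneg_measurable f -> nonneg_measurable g ->
    {ae leb, forall x, g x <= f x} -> rho g <= rho f ;
  fnorm_cvg : forall (u : (Rn -> \bar R)^nat) f,
    (forall k, nonneg_measurable (u k)) -> nonneg_measurable f ->
    {ae leb, forall x, nondecreasing_seq (u ^~ x)} ->
    {ae leb, forall x, u k x @[k --> \oo] --> f x} ->
    rho (u k) @[k --> \oo] --> rho f ;
  fnorm_indic : forall E : set Rn, measurable E -> leb E < +oo ->
    rho (EFin \o \1_E) < +oo ;
  fnorm_integral : forall E : set Rn, measurable E -> leb E < +oo ->
    exists2 C : R, (0 < C)%R & forall f, nonneg_measurable f ->
      \int[leb]_(x in E) f x <= C%:E * rho f }.

(* A Banach function space is given by its function norm rho: its elements are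
   the measurable f with rho |f| < +oo, and its norm is f |-> rho |f|. *)
Record banach_function_space := BanachFunctionSpace {
  bfs_rho : (Rn -> \bar R) -> \bar R ;
  bfs_rhoP : function_norm bfs_rho }.

Definition bfs_norm (Y : banach_function_space) (f : Rn -> \bar R) : \bar R :=
  bfs_rho Y (fun x => `|f x|).

Definition associate_norm (Y : banach_function_space) (f : Rn -> \bar R) :
    \bar R :=
  ereal_sup [set \int[leb]_x `|f x * g x| | g in
    [set g : Rn -> \bar R | measurable_fun [set: Rn] g /\ bfs_norm Y g <= 1]].

Definition dilation (r : R) (f : Rn -> \bar R) : Rn -> \bar R :=
  fun x => f (r *: x)%R.

(* N is the norm of the space Z in ||f||_{Z,Q}. *)
Definition norm_average (N : (Rn -> \bar R) -> \bar R) (Q : cube)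
    (f : Rn -> \bar R) : \bar R :=
  N (dilation (side Q) (fun x => f x * (\1_(cset Q) x)%:E)).

Definition maximal (N : (Rn -> \bar R) -> \bar R) (f : Rn -> \bar R)
    (x : Rn) : \bar R :=
  ereal_sup [set norm_average N Q f | Q in [set Q : cube | cset Q x]].

End definitions.

(* Main.v *)
(** Neither duality nor a maximal theorem is used. For [Q] in [S], the points
  of [Q] lying below exactly [k] further nested cubes of [S] form the k-th layer
  of [Q]; by sparseness it has measure at most [2^-k |Q|], and for fixed [k] the
  layers of distinct cubes are disjoint. Write [a_Q] for the average of [f] over
  [Q]. If [M^p] is the sum over [Q] and [k] of [(th^-k a_Q)^p] times the
  indicator of the k-th layer of [Q], then each [a_Q] is at most [th^k M] on
  the k-th layer, so [T^S f <= M / (1 - th)] almost everywhere. Since [p < q],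
  the integral of [w^p] over the k-th layer is at most
  [2 |Q| ||w||_{q,Q}^p beta^k] with [beta = 2^-(1 - p/q)], and choosing
  [th^p = sqrt beta] makes the sum over [k] converge. Finally, Hölder's
  inequality for [Y] and [Y'] gives [a_Q ||w||_{q,Q} <= C A_Q] with [A_Q] the
  [Y']-average of [fv], and [|Q|] is at most twice the measure of the zeroth
  layer of [Q], on which the maximal function is at least [A_Q]. *)

Require Import Defs.
From mathcomp Require Import all_boot all_order all_algebra.
From mathcomp Require Import all_classical all_reals all_analysis.
From mathcomp Require Import measurable_realfun.
From mathcomp Require Import ring lra.

Set Implicit Arguments.
Unset Strict Implicit.
Unset Printing Implicit Defensive.
Import Order.TTheory GRing.Theory Num.Theory.
Import numFieldNormedType.Exports.

Local Open Scope classical_set_scope.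
Local Open Scope ring_scope.

(** * Integrals of nonnegative functions and countable sums *)

Section integral_lemmas.
Local Open Scope ereal_scope.
Context d (T : measurableType d) (R : realType).
Variable mu : {measure set T -> \bar R}.

(* The integral of a nonnegative function is the supremum over the simple
   functions below it, so monotonicity does not require measurability. *)
Lemma ge0_le_lower_integral (f g : T -> \bar R) :
  (forall x, 0 <= f x) -> (forall x, f x <= g x) ->
  \int[mu]_x f x <= \int[mu]_x g x.
Proof.
move=> f0 fg; rewrite !ge0_integralTE//; last first.
  by move=> x; exact: le_trans (f0 x) (fg x).
apply: ereal_sup_le => _ [h /= hf <-]; exists h => // x.
exact: le_trans (hf x) (fg x).
Qed.

(** No measurability of [f] is at hand, so the bound is made to hold everywhere by raising [g] to
    [+oo] on the null set [N], which leaves its integral unchanged. *)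
Lemma le_lower_integral_null (N : set T) (f g : T -> \bar R) :
  measurable N -> mu N = 0 -> measurable_fun setT g ->
  (forall x, 0 <= f x) -> (forall x, 0 <= g x) ->
  (forall x, ~ N x -> f x <= g x) ->
  \int[mu]_x f x <= \int[mu]_x g x.
Proof.
move=> mN N0 mg f0 g0 fg.
pose h x := g x + +oo * (\1_N x)%:E.
have i0 x : 0 <= +oo * (\1_N x)%:E :> \bar R by rewrite mule_ge0// lee_fin.
have mI : measurable_fun setT (fun x => (\1_N x)%:E : \bar R).
  exact/measurable_EFinP/measurable_indic.
apply: (@le_trans _ _ (\int[mu]_x h x)).
  apply: ge0_le_lower_integral => // x.
  have [Nx|Nx] := pselect (N x); last by rewrite (le_trans (fg x Nx))// leeDl.
  rewrite /h indicE mem_set// mule1 addey ?leey// gt_eqF//.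
  by rewrite (lt_le_trans _ (g0 x)).
have moI : measurable_fun setT (fun x => +oo * (\1_N x)%:E : \bar R).
  by apply: emeasurable_funM => //; exact: measurable_cst.
rewrite ge0_integralD// ge0_integralZl// ?integral_indic ?setIT//; last first.
  by rewrite ?N0 ?mule0 ?adde0.
Qed.

End integral_lemmas.

Section countable_esum.
Local Open Scope ereal_scope.
Context (R : realType) (I : choiceType).

(** [e] lists [S] with gaps marked [None], so finite and infinite [S] are treated alike. The same
    [e] serves every [h], which carries results on series over to sums over [S] whose terms depend
    on a point. *)
Lemma esum_countableE (S : set I) : countable S ->
  exists (e : nat -> option I), forall h : I -> \bar R, (forall i, 0 <= h i) ->
  \esum_(i in S) h i = \sum_(k <oo) oapp h 0 (e k).
Proof.
move=> /countable_injP[f finj].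
pose e k := if pselect (exists2 i, S i & f i = k) is left H
  then Some (sval (cid2 H)) else None.
have eS i : S i -> e (f i) = Some i.
  move=> Si; rewrite /e; case: pselect => [H|[]]; last by exists i.
  congr Some; apply: finj; rewrite ?inE//; case: cid2 => //=.
exists e => h h0.
have o0 k : 0 <= oapp h 0 (e k) by case: (e k) => //=.
rewrite nneseries_esumT// [RHS](_ : _ = \esum_(k in f @` S) oapp h 0 (e k)).
  rewrite esum_image//; apply: eq_esum => i Si; by rewrite eS.
rewrite esum_mkcond [RHS]esum_mkcond; apply: eq_esum => k _.
rewrite in_setT; case: ifPn => // /negP; rewrite inE => nk.
rewrite /e; case: pselect => //= -[i Si fi]; exfalso; apply: nk.
Qed.

Context d (T : measurableType d) (mu : {measure set T -> \bar R}).

Lemma measurable_fun_esum (S : set I) (h : I -> T -> \bar R) : countable S ->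
  (forall i, S i -> measurable_fun setT (h i)) ->
  (forall i x, 0 <= h i x) ->
  measurable_fun setT (fun x => \esum_(i in S) h i x).
Proof.
move=> cS mh h0.
(* [esum_countableE] does not confine the values of [e] to [S]; terms outside [S] are set to zero so
   that every term is measurable. *)
pose g i := if i \in S then h i else cst 0.
have [e eE] := esum_countableE cS.
have g0 i x : 0 <= g i x by rewrite /g; case: ifPn.
rewrite [X in measurable_fun _ X](_ : _ =
    fun x => \sum_(k <oo) oapp (fun i => g i x) 0 (e k)); last first.
  apply/funext => x; rewrite -eE//; apply: eq_esum => i Si.
  by rewrite /g mem_set.
apply: ge0_emeasurable_sum => [k x _ _|k _]; first by case: (e k) => /=.
case: (e k) => [i|] /=; last exact: measurable_cst.
rewrite /g; case: ifPn => [/set_mem/mh//|_]; exact: measurable_cst.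
Qed.

Lemma integral_esum (S : set I) (h : I -> T -> \bar R) : countable S ->
  (forall i, S i -> measurable_fun setT (h i)) ->
  (forall i x, 0 <= h i x) ->
  \int[mu]_x (\esum_(i in S) h i x) = \esum_(i in S) (\int[mu]_x h i x).
Proof.
move=> cS mh h0.
pose g i := if i \in S then h i else cst 0.
have [e eE] := esum_countableE cS.
have g0 i x : 0 <= g i x by rewrite /g; case: ifPn.
transitivity (\int[mu]_x (\sum_(k <oo) oapp (fun i => g i x) 0 (e k))).
  apply: eq_integral => x _; rewrite -eE//; apply: eq_esum => i Si.
  by rewrite /g mem_set.
rewrite integral_nneseries//; last 2 first.
- move=> k; case: (e k) => [i|] /=; last exact: measurable_cst.
  rewrite /g; case: ifPn => [/set_mem/mh//|_]; exact: measurable_cst.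
- by move=> k x _; case: (e k) => /=.
transitivity (\esum_(i in S) (\int[mu]_x g i x)); last first.
  by apply: eq_esum => i Si; rewrite /g mem_set.
rewrite eE; last by move=> i; exact: integral_ge0.
apply: eq_eseriesr => k _; case: (e k) => //=.
by rewrite integral0.
Qed.

End countable_esum.

Section esum_trivIset.
Local Open Scope ereal_scope.
Context (R : realType) (I : choiceType) (T : Type).

(** By disjointness at most one term is nonzero at [x], so the sum collapses to one coefficient or
    to zero. *)
Lemma esum_trivIset (S : set I) (F : I -> set T) (h : I -> \bar R) x :
  (forall i, 0 <= h i) -> trivIset S F ->
  (exists i, [/\ S i, F i x &
     \esum_(j in S) (h j * (\1_(F j) x)%:E) = h i]) \/
  (~ (exists2 i, S i & F i x)) /\ \esum_(j in S) (h j * (\1_(F j) x)%:E) = 0.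
Proof.
move=> h0 tF; have [[i Si Fix]|nF] := pselect (exists2 i, S i & F i x).
  left; exists i; split => //.
  rewrite esum_mkcond -(esum_set1 (h0 i)) [RHS]esum_mkcond.
  apply: eq_esum => j _; case: ifPn => [/set_mem Sj|nSj]; last first.
    by case: ifPn => // /set_mem ji; move: nSj; rewrite ji mem_set.
  rewrite indicE; case: ifPn => [/set_mem -> |nji].
    by rewrite mem_set// mule1.
  rewrite memNset ?mule0// => Fjx; move/negP: nji; apply; rewrite inE /=.
  by apply: tF => //; exists x.
right; split => //; apply: esum1 => i Si; rewrite indicE memNset ?mule0// => Fix.
by apply: nF; exists i.
Qed.

Lemma esum_indic_trivIset (S : set I) (F : I -> set T) x : trivIset S F ->
  \esum_(i in S) (\1_(F i) x)%:E <= (\1_(\bigcup_(i in S) F i) x)%:E :> \bar R.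
Proof.
move=> tF; have := @esum_trivIset S F (cst 1) x (fun=> lee01) tF.
under eq_esum do rewrite mul1e.
move=> [[i [Si Fix ->]]|[_ ->]]; last by rewrite lee_fin.
by rewrite indicE mem_set//; exists i.
Qed.

End esum_trivIset.

Section countable_families.
Local Open Scope ereal_scope.
Context (R : realType) (I : choiceType) (S : set I).
Hypothesis cS : countable S.

Lemma ge0_esumZl (r : R) (h : I -> \bar R) : (forall i, 0 <= h i) ->
  (0 <= r)%R -> \esum_(i in S) (r%:E * h i) = r%:E * \esum_(i in S) h i.
Proof.
move=> h0 r0; have [e eE] := esum_countableE R cS.
rewrite !eE//; last by move=> i; rewrite mule_ge0// lee_fin.
rewrite -nneseriesZl; last by move=> i _; case: (e i) => /=.
by apply: eq_eseriesr => k _; case: (e k) => //=; rewrite mule0.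
Qed.

Lemma countable_bigcup_measurable d (T : measurableType d) (F : I -> set T) :
  (forall i, S i -> measurable (F i)) -> measurable (\bigcup_(i in S) F i).
Proof.
move=> mF; rewrite bigcup_set_type; apply: countable_bigcupT_measurable.
  by rewrite (eq_countable (card_setT _)).
by move=> i; apply: mF; exact: set_valP.
Qed.

Context d (T : measurableType d) (mu : {measure set T -> \bar R}).
Variable F : I -> set T.
Hypothesis mF : forall i, S i -> measurable (F i).

Let mI i : S i -> measurable_fun setT (fun x => (\1_(F i) x)%:E : \bar R).
Proof. by move=> Si; apply/measurable_EFinP/measurable_indic; exact: mF. Qed.

Let I0 i x : 0 <= (\1_(F i) x)%:E :> \bar R.
Proof. by rewrite lee_fin. Qed.

Let integral_esum_indic :
  \int[mu]_x (\esum_(i in S) (\1_(F i) x)%:E) = \esum_(i in S) mu (F i).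
Proof.
rewrite integral_esum//; apply: eq_esum => i Si.
by rewrite integral_indic ?setIT//; exact: mF.
Qed.

(** Here and in the next lemma, a pointwise comparison of the indicator of the union with the sum of
    the indicators is integrated. *)
Lemma measure_bigcup_le_esum :
  mu (\bigcup_(i in S) F i) <= \esum_(i in S) mu (F i).
Proof.
have mU := countable_bigcup_measurable mF.
rewrite -integral_esum_indic -[X in mu X]setIT -integral_indic//.
apply: ge0_le_lower_integral => x; first by rewrite lee_fin.
rewrite indicE; have [|_] := boolP (_ \in _); last exact: esum_ge0.
rewrite inE => -[i Si Fix]; apply: esum_ge; exists [set i].
  by split => // _ ->.
by rewrite fsbig_set1 indicE mem_set.
Qed.

Lemma esum_measure_le_bigcup : trivIset S F ->
  \esum_(i in S) mu (F i) <= mu (\bigcup_(i in S) F i).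
Proof.
move=> tF; have mU := countable_bigcup_measurable mF.
rewrite -integral_esum_indic -[X in mu X]setIT -integral_indic//.
apply: ge0_le_lower_integral => x; first exact: esum_ge0.
exact: esum_indic_trivIset.
Qed.

End countable_families.

Section esum_nneseries.
Local Open Scope ereal_scope.
Context (R : realType) (I : choiceType).

Lemma esum_nneseries (S : set I) (h : I -> nat -> \bar R) : countable S ->
  (forall i k, 0 <= h i k) ->
  \esum_(i in S) (\sum_(k <oo) h i k) = \sum_(k <oo) (\esum_(i in S) h i k).
Proof.
move=> cS h0; have [e eE] := esum_countableE R cS.
rewrite eE; last by move=> i; exact: nneseries_ge0.
transitivity (\sum_(j <oo) \sum_(k <oo) oapp (h^~ k) 0 (e j)).
  apply: eq_eseriesr => j _; case: (e j) => //=.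
  by rewrite eseries0.
rewrite nneseries_interchange; last by move=> j k; case: (e j) => /=.
by apply: eq_eseriesr => k _; rewrite eE.
Qed.

End esum_nneseries.

(** * Boxes, affine maps and the Lebesgue outer measure *)

Section halfspace.
Context (R : realType) (n : nat).
Local Notation V := 'rV[R]_n.+1.

(** [box_below] and [box_above] are the two pieces of a box cut by the hyperplane [x_i = t]. A piece
    may get reversed corners; it is then empty, and the [Num.max] in [box_vol] gives it volume
    zero. *)
Definition box_below (i : 'I_n.+1) (t : R) (ab : V * V) : V * V :=
  (ab.1, \row_j (if j == i then Num.min (ab.2 ord0 j) t else ab.2 ord0 j)).

Definition box_above (i : 'I_n.+1) (t : R) (ab : V * V) : V * V :=
  (\row_j (if j == i then Num.max (ab.1 ord0 j) t else ab.1 ord0 j), ab.2).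

Lemma box_belowE i t ab :
  box (box_below i t ab) = box ab `&` [set x | x ord0 i < t].
Proof.
apply/seteqP; split => x /=.
  move=> h; split => [j|]; last first.
    by have := h i; rewrite mxE eqxx lt_min => /andP[_ /andP[]].
  have /andP[-> /=] := h j; rewrite mxE; case: ifPn => // _.
  by rewrite lt_min => /andP[].
move=> [h xt] j; have /andP[-> /=] := h j.
by rewrite mxE; case: ifPn => // /eqP -> ; rewrite lt_min => ->.
Qed.

Lemma box_aboveE i t ab :
  box (box_above i t ab) = box ab `&` ~` [set x | x ord0 i < t].
Proof.
apply/seteqP; split => x /=.
  move=> h; split => [j|]; last first.
    have := h i; rewrite mxE eqxx ge_max => /andP[/andP[_ ti] _].
    by apply/negP; rewrite -leNgt.
  have /andP[+ ->] := h j; rewrite mxE; case: ifPn => [_|_ ->//].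
  by rewrite ge_max => /andP[->].
move=> [h /negP]; rewrite -leNgt => xt j; have /andP[+ ->] := h j.
by rewrite mxE; case: ifPn => [/eqP -> |_ ->//]; rewrite ge_max => ->/=; rewrite xt.
Qed.

Lemma box_vol_split i t ab :
  box_vol (box_below i t ab) + box_vol (box_above i t ab) = box_vol ab.
Proof.
rewrite /box_vol (bigD1 i)//= [X in _ + X](bigD1 i)//= [RHS](bigD1 i)//=.
rewrite !mxE eqxx.
under eq_bigr => j /negbTE ji do rewrite mxE ji.
under [X in _ + _ * X]eq_bigr => j /negbTE ji do rewrite mxE ji.
rewrite -mulrDl; congr (_ * _).
move: (ab.1 ord0 i) (ab.2 ord0 i) => a b.
rewrite /Num.max /Num.min.
by repeat case: ifPn; rewrite -?leNgt; lra.
Qed.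

(** Cutting every box of a cover of [X] along the hyperplane yields covers of the two parts of [X]
    with the same total volume, which is the Caratheodory criterion. *)
Lemma measurable_halfspace i t :
  measurable ([set x | x ord0 i < t] : set (Rn R n)).
Proof.
apply: le_caratheodory_measurable => X.
apply: le_ereal_inf_tmp => _ [C XC <-].
have -> : (\sum_(k <oo) (box_vol (C k))%:E =
    \sum_(k <oo) (box_vol (box_below i t (C k)))%:E +
    \sum_(k <oo) (box_vol (box_above i t (C k)))%:E)%E.
  rewrite -nneseriesD//; try by move=> *; exact: box_vol_ge0.
  by apply: eq_eseriesr => k _; rewrite -EFinD box_vol_split.
apply: leeD; apply: ereal_inf_lbound => /=.
  exists (box_below i t \o C) => //= x [/XC[k _ Ckx] xt]; exists k => //=.
  by rewrite box_belowE.
exists (box_above i t \o C) => //= x [/XC[k _ Ckx] xt]; exists k => //=.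
by rewrite box_aboveE.
Qed.

Lemma measurable_box (ab : V * V) : measurable (box ab : set (Rn R n)).
Proof.
rewrite (_ : box ab = \bigcap_(i in [set: 'I_n.+1])
   ((~` [set x | x ord0 i < ab.1 ord0 i]) `&` [set x | x ord0 i < ab.2 ord0 i])).
  apply: fin_bigcap_measurable => // i _; apply: measurableI.
    by apply: measurableC; exact: measurable_halfspace.
  exact: measurable_halfspace.
apply/seteqP; split => x /= h i; last first.
  by have [//|/negP] := h i; rewrite -leNgt => -> ->.
by move=> _ /=; have /andP[? ?] := h i; split => //; apply/negP; rewrite -leNgt.
Qed.

End halfspace.

Section affine.
Context (R : realType) (n : nat).
Local Notation V := 'rV[R]_n.+1.
Local Notation lo := (@lebesgue_outer R n).

Definition affine (a : V) (r : R) (x : V) : V := a + r *: x.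

Lemma affineK a r : 0 < r -> cancel (affine a r) (affine (- (r^-1 *: a)) r^-1).
Proof.
move=> r0 x; rewrite /affine scalerDr scalerA mulVf ?gt_eqF// scale1r.
by rewrite addrA addNr add0r.
Qed.

Lemma affineVK a r : 0 < r -> cancel (affine (- (r^-1 *: a)) r^-1) (affine a r).
Proof.
move=> r0 x; rewrite /affine scalerDr scalerN !scalerA divff ?gt_eqF// !scale1r.
by rewrite addrA addrN add0r.
Qed.

Lemma affineVE a r y i :
  affine (- (r^-1 *: a)) r^-1 y ord0 i = (y ord0 i - a ord0 i) / r.
Proof. by rewrite !mxE addrC -mulrBr mulrC. Qed.

Definition affineV_box a r (ab : V * V) : V * V :=
  (affine (- (r^-1 *: a)) r^-1 ab.1, affine (- (r^-1 *: a)) r^-1 ab.2).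

Lemma affine_preimage_box a r (ab : V * V) : 0 < r ->
  affine a r @^-1` box ab = box (affineV_box a r ab).
Proof.
move=> r0; have E i x : (ab.1 ord0 i <= affine a r x ord0 i < ab.2 ord0 i) =
    ((affineV_box a r ab).1 ord0 i <= x ord0 i < (affineV_box a r ab).2 ord0 i).
  rewrite /affineV_box /= !affineVE ler_pdivrMr// ltr_pdivlMr// lerBlDl ltrBrDl.
  by rewrite !mxE (mulrC r).
by apply/seteqP; split => x /= h i; have := h i; rewrite E.
Qed.

Lemma box_vol_affineV a r (ab : V * V) : 0 < r ->
  box_vol (affineV_box a r ab) = (r ^- n.+1) * box_vol ab.
Proof.
move=> r0; rewrite -exprVn -[X in _ ^+ X]card_ord -prodr_const -big_split /=.
apply: eq_bigr => i _; rewrite !affineVE -mulrBl opprD addrACA opprK addNr addr0.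
by rewrite maxr_pMr ?invr_ge0 ?ltW// mulr0 mulrC.
Qed.

(** The boxes of a cover of [A] pull back to boxes covering the preimage, each with its volume
    scaled by the same factor. *)
Lemma le_lebesgue_outer_affine a r A : 0 < r ->
  (lo (affine a r @^-1` A) <= (r ^- n.+1)%:E * lo A)%E.
Proof.
move=> r0; have k0 : 0 < r ^- n.+1 by rewrite invr_gt0 exprn_gt0.
rewrite -lee_pdivrMl//; apply: le_ereal_inf_tmp => _ [C AC <-].
rewrite lee_pdivrMl// -nneseriesZl; last by move=> *; exact: box_vol_ge0.
apply: ereal_inf_lbound; exists (affineV_box a r \o C) => /=.
  by move=> x /AC[k _ Ck]; exists k => //=; rewrite -affine_preimage_box.
by apply: eq_eseriesr => k _; rewrite box_vol_affineV.
Qed.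

(** The missing inequality is the previous lemma for the inverse map. *)
Lemma lebesgue_outer_affine a r A : 0 < r ->
  lo (affine a r @^-1` A) = ((r ^- n.+1)%:E * lo A)%E.
Proof.
move=> r0; apply/eqP; rewrite eq_le le_lebesgue_outer_affine//=.
have {1}-> : A = affine (- (r^-1 *: a)) r^-1 @^-1` (affine a r @^-1` A).
  by apply/seteqP; split => x /=; rewrite affineVK.
rewrite -lee_pdivlMl ?invr_gt0 ?exprn_gt0// invrK.
have := le_lebesgue_outer_affine (- (r^-1 *: a)) (affine a r @^-1` A) (r := r^-1).
by rewrite invr_gt0 exprVn invrK; exact.
Qed.

(** The sigma-algebra is that of Lebesgue, so continuity would not suffice. As the map is bijective,
    every test set is a preimage, and both sides of the Caratheodory criterion for [A] scale by the
    same factor. *)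
Lemma measurable_affine a r : 0 < r ->
  measurable_fun [set: Rn R n] (affine a r : Rn R n -> Rn R n).
Proof.
move=> r0 _ A mA; rewrite setTI.
have {}mA : caratheodory_measurable lo A by [].
suff: caratheodory_measurable lo (affine a r @^-1` A) by [].
move=> X.
have -> : X = affine a r @^-1` (affine (- (r^-1 *: a)) r^-1 @^-1` X).
  by apply/seteqP; split => x /=; rewrite affineK.
move: (_ @^-1` X) => {}X.
rewrite -[X in (_ = X + _)%E]/(lo (affine a r @^-1` (X `&` A))).
rewrite -[X in (_ = _ + X)%E]/(lo (affine a r @^-1` (X `&` ~` A))).
rewrite !lebesgue_outer_affine//.
rewrite -ge0_muleDr//; try exact: lebesgue_outer_ge0.
by congr (_ * _)%E; exact: mA.
Qed.

Lemma ge0_integral_affine a r (f : Rn R n -> \bar R) : 0 < r ->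
  measurable_fun setT f -> (forall x, 0 <= f x)%E ->
  (\int[@leb R n]_x f (affine a r x) = (r ^- n.+1)%:E * \int[@leb R n]_x f x)%E.
Proof.
move=> r0 mf f0; have k0 : 0 <= r ^- n.+1 by rewrite invr_ge0 exprn_ge0// ltW.
have mphi := measurable_affine a r0.
transitivity
  (\int[pushforward (@leb R n) (affine a r : Rn R n -> Rn R n)]_x f x)%E.
  by rewrite ge0_integral_pushforward.
rewrite (eq_measure_integral (mscale (NngNum k0) (@leb R n))) => [|A mA _].
  by rewrite ge0_integral_mscale.
by rewrite /pushforward /mscale /=; exact: lebesgue_outer_affine.
Qed.

End affine.

(** * Dyadic cubes and the layers of a sparse family *)

Section cubes.
Context (R : realType) (n : nat).
Local Notation V := 'rV[R]_n.+1.
Local Notation cube := (cube R n).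
Implicit Types (Q : cube) (x : V).

Lemma csetE Q x :
  cset Q x <-> forall i, Q.1 ord0 i <= x ord0 i < Q.1 ord0 i + side Q.
Proof. by rewrite /cset /box /=; split => h i; have := h i; rewrite !mxE. Qed.

Lemma side_gt0 Q : 0 < side Q.
Proof. by rewrite /side. Qed.

Lemma measurable_cset Q : measurable (cset Q).
Proof. exact: measurable_box. Qed.

Definition unit_cube : cube := (0, PosNum ltr01).

Lemma unit_cube_fin_num : leb (cset unit_cube) \is a fin_num.
Proof.
rewrite ge0_fin_numE//.
pose C k : V * V := if k == 0%N then (0, 0 + const_mx 1) else (0, 0).
apply: (@le_lt_trans _ _ (\sum_(k <oo) (box_vol (C k))%:E)%E).
  apply: ereal_inf_lbound; by exists C => //= x xQ; exists 0%N.
rewrite (nneseries_split 0 1); last by move=> *; exact: box_vol_ge0.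
rewrite eseries0 ?adde0 ?big_nat1 ?ltry// => k /= k1 _.
by rewrite /C gtn_eqF// /box_vol big_ord_recl /= subrr maxxx mul0r.
Qed.

(** An affine map takes [Q] to the unit cube. The measure of the unit cube is kept as a constant, of
    which only finiteness and, later, positivity matter. *)
Lemma leb_cset Q :
  leb (cset Q) = ((side Q ^+ n.+1)%:E * leb (cset unit_cube))%E.
Proof.
have s0 := side_gt0 Q.
have -> : cset Q =
    affine (- ((side Q)^-1 *: (Q.1 : V))) (side Q)^-1 @^-1` cset unit_cube.
  suff E i x : (Q.1 ord0 i <= x ord0 i < Q.1 ord0 i + side Q) =
      (unit_cube.1 ord0 i <=
        affine (- ((side Q)^-1 *: (Q.1 : V))) (side Q)^-1 x ord0 i
        < unit_cube.1 ord0 i + side unit_cube).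
    by apply/seteqP; split => x; rewrite /= !csetE => h i; rewrite ?E// -E.
  rewrite affineVE mxE add0r ler_pdivlMr// ltr_pdivrMr// mul0r mul1r subr_ge0.
  by rewrite ltrBlDl.
by rewrite /leb lebesgue_outer_affine ?invr_gt0// exprVn invrK.
Qed.

Lemma cset_corner Q : cset Q Q.1.
Proof. by apply/csetE => i; rewrite lexx ltrDl side_gt0. Qed.

Lemma sub_csetP Q Q' : cset Q' `<=` cset Q -> forall i,
  Q.1 ord0 i <= Q'.1 ord0 i /\ Q'.1 ord0 i + side Q' <= Q.1 ord0 i + side Q.
Proof.
move=> sQ i; split.
  by have /csetE/(_ i)/andP[] := sQ _ (cset_corner Q').
rewrite leNgt; apply/negP => lt_i.
(* If [Q'] sticks out of [Q] in direction [i], then [t < side Q'], so moving the corner of [Q'] by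
   [t] in all coordinates stays in [Q']; but the [i]-th coordinate reaches the excluded upper face
   of [Q]. *)
pose t := Num.max 0 (Q.1 ord0 i + side Q - Q'.1 ord0 i).
have xQ' : cset Q' ((Q'.1 : V) + const_mx t).
  apply/csetE => j; rewrite !mxE lerDl ltrD2l /t le_max lexx /= gt_max side_gt0 /=.
  by rewrite ltrBlDl.
have /csetE/(_ i)/andP[_] := sQ _ xQ'.
rewrite !mxE ltNge => /negP; apply.
by rewrite -lerBlDl le_max lexx orbT.
Qed.

Lemma sub_cset_side Q Q' : cset Q' `<=` cset Q -> side Q' <= side Q.
Proof. by move=> /sub_csetP/(_ ord0)[]; lra. Qed.

Lemma sub_cset_eq_side Q Q' : cset Q' `<=` cset Q -> side Q' = side Q -> Q' = Q.
Proof.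
move=> sQ es; have := sub_csetP sQ; move: es; rewrite /side.
case: Q sQ => a s; case: Q' => a' s' /= sQ es h; congr (_, _); last exact: val_inj.
by apply/rowP => i; have := h i; rewrite es; lra.
Qed.

Lemma proper_cset_side Q Q' : cset Q' `<` cset Q -> side Q' < side Q.
Proof.
move=> [sQ nQ]; rewrite lt_neqAle sub_cset_side// andbT; apply/eqP => es.
by apply: nQ; rewrite (sub_cset_eq_side sQ es).
Qed.

Lemma cset_inj : injective (@cset R n).
Proof.
move=> Q Q' e; have s1 : cset Q `<=` cset Q' by rewrite e.
have s2 : cset Q' `<=` cset Q by rewrite e.
by apply: sub_cset_eq_side => //; apply/eqP; rewrite eq_le !sub_cset_side.
Qed.

(** The integer parts of the corner divided by [s] identify the cube: if they agree, the corners
    differ by less than [s] in each coordinate, so their coordinatewise maximum lies in both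
    cubes. *)
Lemma countable_same_side (A : set cube) (s : R) :
  (forall Q, A Q -> side Q = s) ->
  trivIset A (@cset R n) -> countable A.
Proof.
move=> As tA; apply/countable_injP.
exists (fun Q => pickle [ffun i => Num.floor (Q.1 ord0 i / s)]) => Q Q'.
rewrite !inE => AQ AQ' /(pcan_inj pickleK)/ffunP eqf.
have s0 : 0 < s by rewrite -(As _ AQ) side_gt0.
apply: tA => //.
exists (\row_i Num.max (Q.1 ord0 i) (Q'.1 ord0 i)).
suff H i : `|Q.1 ord0 i - Q'.1 ord0 i| < s.
  split; apply/csetE => i; rewrite mxE le_max lexx ?orbT /= As// gt_max;
  by have := H i; rewrite ltr_norml => /andP[h1 h2]; apply/andP; split; lra.
have := eqf i; rewrite !ffunE => eqi.
have /andP[] := floor_itv (Q.1 ord0 i / s).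
have /andP[] := floor_itv (Q'.1 ord0 i / s).
rewrite eqi intrD !ler_pdivlMr// !ltr_pdivrMr// mulrDl mul1r => h1 h2 h3 h4.
by rewrite ltr_norml; apply/andP; split; lra.
Qed.

Lemma countable_dyadic (D : int -> set cube) : dyadic_grid D ->
  countable (\bigcup_k D k).
Proof.
move=> [Ds Dp _]; apply: bigcup_countable => // k _.
by apply: (@countable_same_side _ (2 ^ (- k))) => [Q /Ds//|]; case: (Dp k).
Qed.

End cubes.

Section below.
Context (R : realType) (n : nat).
Local Notation cube := (cube R n).
Variable S : set cube.
Implicit Types Q : cube.

Definition subcubes Q : set cube := [set Q' | S Q' /\ cset Q' `<` cset Q].

(* [below k Q] is the set of the points x for which there is a chain
   Q = Q_0 > Q_1 > ... > Q_k of cubes containing x, with Q_1, ..., Q_k in S. *)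
Fixpoint below (k : nat) (Q : cube) : set (Rn R n) :=
  if k is k'.+1 then \bigcup_(Q' in subcubes Q) below k' Q' else cset Q.

Definition layer (k : nat) (Q : cube) : set (Rn R n) :=
  below k Q `\` below k.+1 Q.

Lemma below_mono k Q Q' : cset Q' `<=` cset Q -> below k Q' `<=` below k Q.
Proof.
case: k => [//|k] sQ x [P [SP [PQ' nPQ']] Px]; exists P => //; split => //.
by split; [exact: subset_trans sQ|move=> /(subset_trans sQ)].
Qed.

Lemma belowS k Q : below k.+1 Q `<=` below k Q.
Proof.
elim: k Q => [|k IH] Q x [Q' [SQ' [sQ' nQ']] Q'x]; first exact: sQ'.
by exists Q' => //; exact: IH.
Qed.

Lemma below_sub k Q : below k Q `<=` cset Q.
Proof. by elim: k => [//|k IH]; apply: subset_trans IH; exact: belowS. Qed.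

Lemma layer_exists Q x : cset Q x -> ~ (\bigcap_k below k Q) x ->
  exists k, layer k Q x.
Proof.
move=> Qx nx; apply: contra_notP nx => nl k _.
elim: k => [//|k IH]; apply: contra_notP nl => nk; by exists k.
Qed.

Variable D : int -> set cube.
Hypotheses (dD : dyadic_grid D) (sS : sparse D S).

Lemma countable_sparse : countable S.
Proof.
apply: sub_countable (countable_dyadic dD); apply: subset_card_le; exact: sS.1.
Qed.

Lemma countable_subcubes Q : countable (subcubes Q).
Proof.
by apply: sub_countable countable_sparse; apply: subset_card_le => Q' [].
Qed.

Lemma measurable_below k Q : measurable (below k Q).
Proof.
elim: k Q => [|k IH] Q; first exact: measurable_cset.
by apply: countable_bigcup_measurable; first exact: countable_subcubes.
Qed.

Lemma measurable_layer k Q : measurable (layer k Q).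
Proof. by apply: measurableD; exact: measurable_below. Qed.

Lemma sparse_nested Q Q' x : S Q -> S Q' -> cset Q x -> cset Q' x ->
  [\/ Q = Q', cset Q `<` cset Q' | cset Q' `<` cset Q].
Proof.
move=> SQ SQ' Qx Q'x; have [k _ Dk] := sS.1 _ SQ; have [l _ Dl] := sS.1 _ SQ'.
have [->|/eqP nQ] := eqVneq Q Q'; first by constructor 1.
have [_ _ /(_ _ _ _ _ Dk Dl)[h|h|h]] := dD.
- constructor 2; split => // h'; apply: nQ; apply: cset_inj.
  by apply/seteqP.
- constructor 3; split => // h'; apply: nQ; apply: cset_inj.
  by apply/seteqP.
- have : (cset Q `&` cset Q') x by [].
  by rewrite h.
Qed.

(** Of two distinct cubes of [S] sharing a point, one lies strictly inside the other. A chain of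
    length [k] below the smaller one, prefixed by the larger, has length [k.+1], so the point is not
    in the [k]-th layer of the larger. *)
Lemma trivIset_layer k : trivIset S (layer k).
Proof.
move=> Q Q' SQ SQ' [x [[Qx nQx] [Q'x nQ'x]]].
have [//|QQ'|Q'Q] := sparse_nested SQ SQ' (below_sub Qx) (below_sub Q'x).
- by exfalso; apply: nQ'x; exists Q.
- by exfalso; apply: nQx; exists Q'.
Qed.

Definition maximal_subcubes Q : set cube :=
  [set Q' | subcubes Q Q' /\ forall P, subcubes Q P -> ~ cset Q' `<` cset P].

(** A subcube of [Q] lies some [m] generations below [Q], and passing to a strictly larger subcube
    lowers [m], so the ascent ends at a maximal one. *)
Lemma sub_maximal_subcube Q Q' : S Q -> subcubes Q Q' ->
  exists2 P, maximal_subcubes Q P & cset Q' `<=` cset P.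
Proof.
have [Ds _ _] := dD.
move=> SQ; have [k _ Dk] := sS.1 _ SQ.
have level P : subcubes Q P -> exists m : nat, D (k + m%:Z) P.
  move=> [/sS.1[l _ Dl]] /proper_cset_side; rewrite (Ds _ _ Dl) (Ds _ _ Dk).
  rewrite ltr_eXz2l ?ltr1n// ltrN2 => kl.
  by exists `|l - k|%N; rewrite gez0_abs ?subr_ge0 ?ltW// subrKC.
move=> sQ'; have [m Dm] := level _ sQ'.
elim/ltn_ind: m Q' sQ' Dm => m IH Q' sQ' Dm.
have [mQ'|] := pselect (forall P, subcubes Q P -> ~ cset Q' `<` cset P).
  by exists Q'.
move=> /existsNP[P /not_implyP[sP /contrapT Q'P]].
have [l Dl] := level _ sP.
have lm : (l < m)%N.
  move/proper_cset_side : (Q'P); rewrite (Ds _ _ Dl) (Ds _ _ Dm).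
  by rewrite ltr_eXz2l ?ltr1n// ltrN2 ltrD2l.
have [P' mP' PP'] := IH _ lm _ sP Dl.
by exists P' => //; apply: subset_trans PP'; case: Q'P.
Qed.

Lemma trivIset_maximal_subcubes Q : trivIset (maximal_subcubes Q) (@cset R n).
Proof.
move=> P P' [[SP PQ] mP] [[SP' P'Q] mP'] [x [Px P'x]].
by have [//|/mP[]|/mP'[]] := sparse_nested SP SP' Px P'x.
Qed.

Local Open Scope ereal_scope.

(** Since [below k] is monotone, the union defining [below k.+1 Q] may be restricted to the maximal
    subcubes. These are disjoint, so their measures add up to at most [|Q| / 2] by sparseness; each
    step of the induction thus gains a factor 1/2. *)
Lemma leb_below k Q : S Q ->
  leb (below k Q) <= ((2^-1)%R ^+ k)%:E * leb (cset Q).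
Proof.
have cM P : countable (maximal_subcubes P).
  by apply: sub_countable countable_sparse; apply: subset_card_le => Q' [[]].
elim: k Q => [|k IH] Q SQ; first by rewrite expr0 mul1e.
have -> : below k.+1 Q = \bigcup_(P in maximal_subcubes Q) below k P.
  apply/seteqP; split => x [Q' sQ' Q'x].
    have [P mP Q'P] := sub_maximal_subcube SQ sQ'.
    by exists P => //; exact: below_mono Q'x.
  by exists Q' => //; case: sQ'.
apply: le_trans (measure_bigcup_le_esum _ _ _) _ => //.
  by move=> P _; exact: measurable_below.
apply: (@le_trans _ _
    (\esum_(P in maximal_subcubes Q) (((2^-1)%R ^+ k)%:E * leb (cset P)))).
  by apply: le_esum => P [[SP _] _]; exact: IH.
rewrite ge0_esumZl// ?exprn_ge0// exprSr EFinM -muleA.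
apply: lee_wpmul2l; first by rewrite lee_fin exprn_ge0.
apply: le_trans (esum_measure_le_bigcup _ _ _ _) _ => //.
- by move=> P _; exact: measurable_cset.
- exact: trivIset_maximal_subcubes.
apply: le_trans (sS.2 _ SQ); apply: le_measure; rewrite ?inE.
- by apply: countable_bigcup_measurable => // P _; exact: measurable_cset.
- apply: countable_bigcup_measurable; first exact: countable_subcubes.
  by move=> P _; exact: measurable_cset.
- by move=> x [P [sP _] Px]; exists P.
Qed.

Hypothesis unit_gt0 : 0 < leb (cset (unit_cube R n)).

Lemma leb_cset_fin_num Q : leb (cset Q) \is a fin_num.
Proof. by rewrite leb_cset fin_numM// unit_cube_fin_num. Qed.

Lemma leb_cset_gt0 Q : 0 < leb (cset Q).
Proof. by rewrite leb_cset mule_gt0// lte_fin exprn_gt0// side_gt0. Qed.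

(** Hence almost every point of [Q] lies in some layer of [Q]. *)
Lemma leb_bigcap_below Q : S Q -> leb (\bigcap_k below k Q) = 0.
Proof.
move=> SQ; have mU := measurable_below _ Q.
apply/eqP; rewrite eq_le measure_ge0 andbT.
have h k : leb (\bigcap_k below k Q) <= ((2^-1)%R ^+ k * fine (leb (cset Q)))%:E.
  apply: (@le_trans _ _ (leb (below k Q))).
    apply: le_measure; rewrite ?inE//; first exact: bigcapT_measurable.
    by move=> x; exact.
  by rewrite EFinM fineK ?leb_cset_fin_num// leb_below.
have cv : ((2^-1)%R ^+ k * fine (leb (cset Q)))%:E @[k --> \oo] --> 0.
  apply: cvg_EFin; first by near=> k.
  rewrite -[X in _ --> X](mul0r (fine (leb (cset Q)))).
  apply: cvgMl; apply: cvg_expr.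
  by rewrite ger0_norm ?invr_ge0// invf_lt1// ltr1n.
rewrite -(cvg_lim _ cv)//; apply: lime_ge; first by apply/cvg_ex; exists 0.
by near=> k; exact: h.
Unshelve. all: by end_near. Qed.

(** The cubes of [S] strictly inside [Q] remove at most half of it. *)
Lemma leb_cset_le_layer0 Q : S Q -> leb (cset Q) <= 2%:E * leb (layer 0 Q).
Proof.
move=> SQ; have mU k := measurable_below k Q.
have := leb_cset_fin_num Q; have := leb_below 1 SQ.
have -> : leb (layer 0 Q) = leb (cset Q) - leb (below 1 Q).
  rewrite /layer measureD//; last by rewrite ltey_eq leb_cset_fin_num.
  by rewrite setIidr//; exact: below_sub.
have : 0 <= leb (below 1 Q) by [].
case: (leb (cset Q)) => // a; case: (leb (below 1 Q)) => [b| |]//.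
by rewrite expr1 -!EFinM !lee_fin; lra.
Qed.

End below.

(** * Summing over the layers *)

Section geometric.
Local Open Scope ereal_scope.
Context (R : realType).

Lemma powR_exprn (a r : R) k : (0 <= a)%R -> ((a ^+ k) `^ r = (a `^ r) ^+ k)%R.
Proof.
by move=> a0; rewrite -(powR_mulrn k a0) powRAC powR_mulrn// powR_ge0.
Qed.

Lemma powR_exprVn (a r : R) k : (0 <= a)%R -> ((a ^- k) `^ r = (a `^ r) ^- k)%R.
Proof.
move=> a0; rewrite -exprVn powR_exprn ?invr_ge0// -exprVn; congr (_ ^+ _)%R.
by rewrite -powR_inv1// powRAC powR_inv1// powR_ge0.
Qed.

Lemma powR_gt0_lt1 (a r : R) : (0 < a < 1)%R -> (0 < r)%R -> (0 < a `^ r < 1)%R.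
Proof.
move=> /andP[a0 a1] r0; rewrite powR_gt0//=.
have -> : (1 = 1 `^ r :> R)%R by rewrite powR1.
by rewrite gt0_ltr_powR ?nnegrE ?(ltW a0).
Qed.

Lemma geometric_eseries (z : R) : (0 <= z < 1)%R ->
  \sum_(k <oo) (z ^+ k)%:E = ((1 - z)^-1)%:E.
Proof.
move=> /andP[z0 z1]; apply/cvg_lim => //.
rewrite (_ : (fun m => _) = EFin \o series (geometric 1 z)); last first.
  apply/funext => m; rewrite /series /= -sumEFin; apply: eq_bigr => k _.
  by rewrite mul1r.
apply: cvg_EFin; first by near=> m.
rewrite -[X in _ --> X](mul1r (1 - z)^-1%R).
by apply: cvg_geometric_series; rewrite ger0_norm.
Unshelve. all: by end_near. Qed.

End geometric.

Section weighted_power.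
Local Open Scope ereal_scope.
Context d (T : measurableType d) (R : realType).
Variable mu : {measure set T -> \bar R}.

(** Truncation at height [s]: below it the first term suffices; above it, [a^p = a^(p-q) a^q] and
    the exponent [p - q] is negative. *)
Lemma powR_le_trunc (p q s a : R) : (0 < p < q)%R -> (0 < s)%R -> (0 <= a)%R ->
  (a `^ p <= s `^ p + s `^ (p - q) * a `^ q)%R.
Proof.
move=> /andP[p0 pq] s0 a0; have [ast|sa] := leP a s.
  rewrite -[leLHS]addr0 lerD ?mulr_ge0 ?powR_ge0//.
  by rewrite ge0_ler_powR ?nnegrE// ltW.
rewrite -[leLHS]add0r lerD ?powR_ge0//.
have {1}-> : p = (p - q + q)%R by rewrite subrK.
rewrite powRD; last by apply/implyP => _; rewrite gt_eqF// (lt_trans s0).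
rewrite ler_wpM2r ?powR_ge0// -opprB !powRN lef_pV2 ?posrE ?powR_gt0//.
  by rewrite ge0_ler_powR ?nnegrE ?subr_ge0// ltW.
exact: lt_trans sa.
Qed.

(** This takes the place of Hölder's inequality on a small subset [E] of [F]; the height [s] is free
    and is later chosen to balance the two terms. *)
Lemma integral_powR_trunc (u : T -> R) (E F : set T) (p q s : R) :
  measurable_fun setT u -> measurable E -> measurable F -> E `<=` F ->
  (0 < p < q)%R -> (0 < s)%R ->
  \int[mu]_(x in E) (`|u x| `^ p)%:E <=
  (s `^ p)%:E * mu E + (s `^ (p - q))%:E * \int[mu]_(x in F) (`|u x| `^ q)%:E.
Proof.
move=> mu_ mE mF EF pq s0.
have mpow r D : measurable_fun D (fun x => (`|u x| `^ r)%:E).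
  apply: measurable_funTS; apply/measurable_EFinP.
  apply: (measurableT_comp (measurable_powR r)).
  exact: measurableT_comp.
have p0 r x : 0 <= (`|u x| `^ r)%:E by rewrite lee_fin powR_ge0.
apply: (@le_trans _ _ (\int[mu]_(x in E) ((s `^ p)%:E +
    (s `^ (p - q))%:E * (`|u x| `^ q)%:E))).
  apply: ge0_le_integral => //.
    by apply: emeasurable_funD => //; apply: measurable_funeM.
  by move=> x _; rewrite -EFinM -EFinD lee_fin powR_le_trunc.
rewrite ge0_integralD//; last 3 first.
- by move=> x _; rewrite lee_fin powR_ge0.
- by move=> x _; rewrite mule_ge0// lee_fin powR_ge0.
- by apply: measurable_funeM.
rewrite integral_cst// ge0_integralZl_EFin ?powR_ge0//.
by apply: leeD => //; apply: lee_wpmul2l; [rewrite lee_fin powR_ge0|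
  exact: ge0_subset_integral].
Qed.

End weighted_power.

Section layers.
Local Open Scope ereal_scope.
Context (R : realType) (n : nat).
Variables (D : int -> set (cube R n)) (S : set (cube R n)).
Hypotheses (dD : dyadic_grid D) (sS : sparse D S).
Variables (p th : R).
Hypotheses (p0 : (0 < p)%R) (th01 : (0 < th < 1)%R).
Implicit Types (Q : cube R n) (a : cube R n -> \bar R).

(** The layers of one cube are disjoint, so this is [th^(-kp)] on the [k]-th layer of [Q] and zero
    off the layers. *)
Definition depth_weight Q (x : Rn R n) : \bar R :=
  \sum_(k <oo) (((th ^- k) `^ p)%:E * (\1_(layer S k Q) x)%:E).

Lemma depth_weight_term_ge0 k Q x :
  0 <= ((th ^- k) `^ p)%:E * (\1_(layer S k Q) x)%:E.
Proof. by rewrite mule_ge0// lee_fin ?powR_ge0. Qed.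

Lemma depth_weight_ge0 Q x : 0 <= depth_weight Q x.
Proof. by apply: nneseries_ge0 => k _ _; exact: depth_weight_term_ge0. Qed.

Lemma depth_weight_layer k Q x : layer S k Q x ->
  ((th ^- k) `^ p)%:E <= depth_weight Q x.
Proof.
move=> lx.
apply: le_trans (nneseries_lim_ge (k.+1) _); last first.
  by move=> ? _ _; exact: depth_weight_term_ge0.
rewrite big_nat_recr//= indicE mem_set// mule1 leeDr// sume_ge0// => i _.
exact: depth_weight_term_ge0.
Qed.

(* If a_Q <= th^k M whenever x lies in the k-th layer of Q, then the k-th
   layers contribute at most th^k M to the sum, as they are disjoint. *)
Lemma sparse_sum_le a x : (forall Q, 0 <= a Q) ->
  (forall Q, S Q -> ~ (\bigcap_k below S k Q) x) ->
  (\esum_(Q in S) (a Q * (\1_(cset Q) x)%:E)) `^ p <=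
  (((1 - th)^-1) `^ p)%:E * \esum_(Q in S) (a Q `^ p * depth_weight Q x).
Proof.
move=> a0 nx; have /andP[th0 th1] := th01.
set G := \esum_(Q in S) (a Q `^ p * _).
have cS := countable_sparse dD sS.
have G0 : 0 <= G.
  by apply: esum_ge0 => Q _; rewrite mule_ge0 ?poweR_ge0 ?depth_weight_ge0.
have C0 : (0 < (1 - th)^-1)%R by rewrite invr_gt0 subr_gt0.
have [Goo|Gfin] := eqVneq G +oo.
  by rewrite Goo gt0_muley ?leey// lte_fin powR_gt0.
have Gf : G \is a fin_num by rewrite ge0_fin_numE// ltey.
(* On the [k]-th layer of [Q] the single term of [Q] in [G] is at least [(th^-k a_Q)^p]; comparing
   it with [G = M^p] gives [aM]. *)
pose M := (fine G `^ p^-1)%R.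
have M0 : (0 <= M)%R by rewrite powR_ge0.
have aM Q k : S Q -> layer S k Q x -> a Q <= (M * th ^+ k)%:E.
  move=> SQ lx.
  have tk0 : (0 < th ^- k)%R by rewrite invr_gt0 exprn_gt0.
  have : a Q * (th ^- k)%:E <= G `^ p^-1.
    have -> : a Q * (th ^- k)%:E = ((a Q * (th ^- k)%:E) `^ p) `^ p^-1.
      rewrite -poweRrM divff ?gt_eqF// poweRe1// mule_ge0// lee_fin ltW//.
    have q0 : 0 <= a Q * (th ^- k)%:E by rewrite mule_ge0// lee_fin ltW.
    apply: gt0_ler_poweR; rewrite ?invr_ge0 ?(ltW p0)//;
      rewrite ?in_itv/= ?poweR_ge0 ?leey ?G0//.
    rewrite poweRM//; last by rewrite lee_fin ltW.
    apply: esum_ge; exists [set Q]; first by split => // _ ->.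
    by rewrite fsbig_set1 lee_wpmul2l ?poweR_ge0// poweR_EFin depth_weight_layer.
  rewrite -(fineK Gf) poweR_EFin -/M => h.
  by rewrite EFinM -lee_pdivrMr ?exprn_gt0.
have -> : (((1 - th)^-1) `^ p)%:E * G = (((1 - th)^-1)%:E * M%:E) `^ p.
  rewrite poweRM ?lee_fin// ?(ltW C0)// !poweR_EFin -powRrM mulVf ?gt_eqF//.
  by rewrite powRr1 ?fine_ge0// fineK.
have e0 Q : S Q -> 0 <= a Q * (\1_(cset Q) x)%:E.
  by move=> _; rewrite mule_ge0// lee_fin.
apply: gt0_ler_poweR; rewrite ?(ltW p0)// ?in_itv/= ?leey ?andbT ?esum_ge0//.
  by rewrite mule_ge0// lee_fin ?(ltW C0).
have t0 Q k : 0 <= (M * th ^+ k)%:E * (\1_(layer S k Q) x)%:E.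
  by rewrite mule_ge0// lee_fin// mulr_ge0// exprn_ge0// ltW.
(* By [nx], a cube of [S] containing [x] has [x] in one of its layers, and the term of that layer
   alone dominates [a Q]. *)
apply: (@le_trans _ _ (\esum_(Q in S)
    \sum_(k <oo) ((M * th ^+ k)%:E * (\1_(layer S k Q) x)%:E))).
  apply: le_esum => Q SQ.
  have [Qx|nQx] := pselect (cset Q x); last first.
    by rewrite indicE memNset// mule0 nneseries_ge0.
  have [k lx] := layer_exists Qx (nx Q SQ).
  rewrite indicE mem_set// mule1.
  apply: le_trans (nneseries_lim_ge (k.+1) _); last by move=> ? _ _.
  rewrite big_nat_recr//= (indicE _ (layer S k Q)) mem_set// mule1.
  by rewrite (le_trans (aM Q k SQ lx))// leeDr// sume_ge0.
rewrite esum_nneseries//.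
apply: (@le_trans _ _ (\sum_(k <oo) (M%:E * (th ^+ k)%:E))).
  apply: lee_nneseries => [k _ _|k _]; first exact: esum_ge0.
  have c0 : forall Q : cube R n, 0 <= (M * th ^+ k)%:E.
    by move=> _; rewrite lee_fin mulr_ge0// exprn_ge0// ltW.
  have [[Q [_ _ ->]]|[_ ->]] := esum_trivIset x c0 (trivIset_layer (k := k) dD sS).
    by rewrite EFinM.
  by rewrite mule_ge0// lee_fin// exprn_ge0// ltW.
rewrite nneseriesZl; last by move=> k _; rewrite lee_fin exprn_ge0// ltW.
by rewrite geometric_eseries ?(ltW th0)//= muleC.
Qed.

Lemma measurable_depth_weight Q : measurable_fun setT (depth_weight Q).
Proof.
apply: ge0_emeasurable_sum => [k x _ _|k _]; first exact: depth_weight_term_ge0.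
apply: measurable_funeM; apply/measurable_EFinP; apply: measurable_indic.
exact: measurable_layer dD sS _ _.
Qed.

End layers.

Section layers_integral.
Local Open Scope ereal_scope.
Context (R : realType) (n : nat).
Variables (D : int -> set (cube R n)) (S : set (cube R n)).
Hypotheses (dD : dyadic_grid D) (sS : sparse D S).
Hypothesis unit_gt0 : 0 < leb (cset (unit_cube R n)).
Variables (p q : R).
Hypothesis pq : (0 < p < q)%R.
Variables (u : Rn R n -> R).
Hypothesis mu : measurable_fun setT u.
Local Notation leb := (@leb R n).
Local Notation beta := (2^-1 `^ (1 - p / q))%R.

Let p0 : (0 < p)%R. Proof. by case/andP: pq. Qed.
Let q0 : (0 < q)%R. Proof. by case/andP: pq => ?; exact: lt_trans. Qed.

Lemma Lp_averageXE Q : leb (cset Q) * Lp_average q Q (EFin \o u) `^ q =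
  \int[leb]_(x in cset Q) (`|u x| `^ q)%:E.
Proof.
have I0 : 0 <= \int[leb]_(x in cset Q) (`|u x| `^ q)%:E.
  by apply: integral_ge0 => x _; rewrite lee_fin powR_ge0.
rewrite /Lp_average -poweRrM mulVf ?gt_eqF// poweRe1; last first.
  by rewrite mule_ge0 ?inve_ge0// integral_ge0// => x _; exact: poweR_ge0.
rewrite /average muleA muleC.
have Q0 := leb_cset_gt0 unit_gt0 Q; have Qf := leb_cset_fin_num Q.
rewrite (muleC (leb _)) mulVe ?gt_eqF// mule1.
by apply: eq_integral.
Qed.

Lemma integral_layer_le Q (W : R) k : S Q -> (0 < W)%R ->
  Lp_average q Q (EFin \o u) = W%:E ->
  \int[leb]_(x in layer S k Q) (`|u x| `^ p)%:E <=
  (2 * W `^ p * beta ^+ k)%:E * leb (cset Q).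
Proof.
move=> SQ W0 WE.
have h2 : (0 < 2^-1 :> R)%R by rewrite invr_gt0.
(* This is [2^(k/q) W]. Both terms [s^p 2^-k |Q|] and [s^(p-q) W^q |Q|] then equal [W^p beta^k |Q|],
   whence the factor 2. *)
pose s := ((2^-1 `^ - (q^-1)) ^+ k * W)%R.
have s0 : (0 < s)%R by rewrite mulr_gt0// exprn_gt0// powR_gt0.
have mL := measurable_layer dD sS k Q.
have LQ : layer S k Q `<=` cset Q by move=> x [/below_sub].
apply: le_trans (integral_powR_trunc _ mu mL (measurable_cset Q) LQ pq s0) _.
rewrite -Lp_averageXE WE -(fineK (leb_cset_fin_num Q)) poweR_EFin.
have : leb (layer S k Q) <= ((2^-1)%R ^+ k)%:E * leb (cset Q).
  apply: le_trans (leb_below dD sS k SQ); apply: le_measure; rewrite ?inE//.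
    exact: measurable_below dD sS _ _.
  by move=> x [].
move=> /(lee_wpmul2l (x := (s `^ p)%:E)); rewrite lee_fin powR_ge0 => /(_ isT).
move=> /leeD /(_ (lexx ((s `^ (p - q))%:E *
   ((fine (leb (cset Q)))%:E * (W `^ q)%:E)))) /le_trans; apply.
rewrite -(fineK (leb_cset_fin_num Q)) -!EFinM -EFinD.
rewrite lee_fin fineK ?leb_cset_fin_num//.
move: (fine _) => m.
have sr r : (s `^ r = (2^-1 `^ (- q^-1 * r)) ^+ k * W `^ r)%R.
  rewrite /s powRM ?exprn_ge0 ?powR_ge0 ?(ltW W0)// powR_exprn ?powR_ge0//.
  by rewrite -powRrM.
rewrite !sr.
have -> : ((2^-1 `^ (- q^-1 * (p - q))) = beta)%R.
  by congr (_ `^ _)%R; rewrite mulrBr !mulNr opprK mulVf ?gt_eqF// addrC mulrC.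
have -> : (W `^ (p - q) = W `^ p / W `^ q)%R.
  by rewrite powRD ?powRN//; apply/implyP => _; rewrite gt_eqF.
have bE : (beta ^+ k = (2^-1 `^ (- q^-1 * p)) ^+ k * 2^-1 ^+ k)%R.
  rewrite -exprMn; congr (_ ^+ _)%R.
  rewrite powRD; last by apply/implyP => _; rewrite gt_eqF.
  by rewrite powRr1 1?ltW// mulrC; congr (_ `^ _ * _)%R; rewrite mulNr mulrC.
have Wq : (W `^ q != 0)%R by rewrite gt_eqF// powR_gt0.
rewrite bE; move: (W `^ q)%R Wq (W `^ p)%R (_ ^+ k)%R (2^-1 ^+ k)%R => w w0 x y z.
by rewrite le_eqVlt; apply/orP; left; apply/eqP; field.
Qed.

Lemma beta01 : (0 < beta < 1)%R.
Proof.
have /andP[_ pltq] := pq; apply: powR_gt0_lt1.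
  by rewrite invr_gt0 invf_lt1 ?ltr1n ?ltr0n.
by rewrite subr_gt0 ltr_pdivrMr ?mul1r.
Qed.

(** With [g] the square root of [beta], the choice of [th] gives [th^p = g]. The [k]-th layer
    carries the weight [g^-k] and contributes a multiple of [g^-k beta^k = g^k], a convergent
    geometric series. *)
Lemma integral_depth_weight_le Q (W : R) : S Q -> (0 < W)%R ->
  Lp_average q Q (EFin \o u) = W%:E ->
  \int[leb]_x ((`|u x| `^ p)%:E * depth_weight S p (beta `^ (2 * p)^-1) Q x) <=
  (2 * W `^ p / (1 - beta `^ 2^-1))%:E * leb (cset Q).
Proof.
move=> SQ W0 WE; have b01 := beta01.
set th := (beta `^ _)%R; set g := (beta `^ _)%R.
have /andP[g0 g1] : (0 < g < 1)%R by apply: powR_gt0_lt1; rewrite ?invr_gt0.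
have thg k : ((th ^- k) `^ p = g ^- k)%R.
  have thp : (th `^ p = g)%R.
    by rewrite -powRrM invfM -mulrA mulVf ?mulr1 ?gt_eqF.
  by rewrite powR_exprVn ?thp; last exact: powR_ge0.
have mpow : measurable_fun setT (fun x : Rn R n => (`|u x| `^ p)%:E).
  apply/measurable_EFinP; apply: (measurableT_comp (measurable_powR p)).
  exact: measurableT_comp.
have mL k := measurable_layer dD sS k Q.
have bg : (beta = g * g)%R.
  by rewrite -expr2 -powR_mulrn ?powR_ge0// -powRrM mulVf ?powRr1 ?powR_ge0.
clearbody th g; have Qf := leb_cset_fin_num Q.
have mI k : measurable_fun setT (fun x : Rn R n => (\1_(layer S k Q) x)%:E).
  by apply/measurable_EFinP; apply: measurable_indic; exact: mL.
rewrite [leLHS](_ : _ = \int[leb]_x (\sum_(k <oo)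
    ((g ^- k)%:E * ((`|u x| `^ p)%:E * (\1_(layer S k Q) x)%:E)))); last first.
  apply: eq_integral => x _; rewrite -nneseriesZl; last first.
    by move=> k _; exact: depth_weight_term_ge0.
  by apply: eq_eseriesr => k _; rewrite thg muleCA.
have mt k : measurable_fun setT
    (fun x : Rn R n => (`|u x| `^ p)%:E * (\1_(layer S k Q) x)%:E).
  by apply: emeasurable_funM; [exact: mpow|exact: mI].
have t0 k x : 0 <= (`|u x| `^ p)%:E * (\1_(layer S k Q) x)%:E.
  by rewrite mule_ge0// lee_fin ?powR_ge0.
have gk0 k : (0 <= g ^- k)%R by rewrite invr_ge0 exprn_ge0// ltW.
rewrite integral_nneseries; last 3 first.
- exact: measurableT.
- by move=> k; apply: measurable_funeM; exact: mt.
- by move=> k x _; rewrite mule_ge0// lee_fin.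
apply: (@le_trans _ _ (\sum_(k <oo)
    ((2 * W `^ p * fine (leb (cset Q)))%:E * (g ^+ k)%:E))); last first.
  rewrite nneseriesZl; last by move=> k _; rewrite lee_fin exprn_ge0// ltW.
  rewrite geometric_eseries ?(ltW g0)// -EFinM -(fineK (leb_cset_fin_num Q)) -EFinM.
  by rewrite lee_fin mulrAC.
apply: lee_nneseries => [k _ _|k _].
  by apply: integral_ge0 => x _; rewrite mule_ge0// lee_fin.
rewrite ge0_integralZl_EFin; last 4 first.
- exact: measurableT.
- by move=> x _; exact: t0.
- exact: mt.
- exact: gk0.
rewrite [X in _ * X](_ : _ = \int[leb]_(x in layer S k Q) (`|u x| `^ p)%:E).
  2: by rewrite [RHS]integral_mkcond; apply: eq_integral => x _; rewrite epatch_indic.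
apply: le_trans (lee_wpmul2l _ (integral_layer_le k SQ W0 WE)) _.
  by rewrite lee_fin.
rewrite -(fineK (leb_cset_fin_num Q)) -!EFinM lee_fin.
have -> : (beta ^+ k = g ^+ k * g ^+ k)%R.
  by rewrite -exprMn bg.
have gn0 : (g ^+ k != 0)%R by rewrite gt_eqF// exprn_gt0.
move: (fine _) (W `^ p)%R (g ^+ k)%R gn0 => a b c c0.
rewrite le_eqVlt; apply/orP; left; by apply/eqP => /=; field.
Qed.

End layers_integral.

(** * Averages in a Banach function space *)

Section holder_associate.
Local Open Scope ereal_scope.
Context (R : realType) (n : nat).
Local Notation Rn := (Rn R n).
Local Notation leb := (@leb R n).

Lemma ae_pos_integral_gt0 (E : set Rn) (u : Rn -> \bar R) :
  measurable E -> 0 < leb E -> measurable_fun setT u -> (forall x, 0 <= u x) ->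
  {ae leb, forall x, 0 < u x} -> 0 < \int[leb]_(x in E) u x.
Proof.
move=> mE E0 mu_ u0 aeu; rewrite lt_neqAle integral_ge0// andbT eq_sym.
apply/eqP => I0.
have /(ae_eq_integral_abs leb mE (measurable_funTS mu_)) aeE :
    \int[leb]_(x in E) `|u x| = 0.
  by rewrite -[RHS]I0; apply: eq_integral => x _; rewrite gee0_abs.
have : leb.-negligible E.
  have : {ae leb, forall x, ~ E x}.
    by apply: filterS2 aeu aeE => x ux Ex /Ex u0x; move: ux; rewrite u0x ltxx.
  by apply: negligibleS => x Ex /=; apply.
by move=> /(measure_negligible mE) E00; move: E0; rewrite E00 ltxx.
Qed.

Variable Y : banach_function_space R n.

Lemma measurable_abse (g : Rn -> \bar R) : measurable_fun setT g ->
  measurable_fun setT (fun x => `|g x|).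
Proof.
by move=> mg; apply: measurableT_comp; [exact: abse_measurable|exact: mg].
Qed.

(** The definition of the associate norm is tested on [g] divided by its norm, which must therefore
    be positive and finite. *)
Lemma holder_associate (f g : Rn -> \bar R) :
  measurable_fun setT f -> measurable_fun setT g ->
  0 < bfs_norm Y g -> bfs_norm Y g \is a fin_num ->
  \int[leb]_x `|f x * g x| <= associate_norm Y f * bfs_norm Y g.
Proof.
move=> mf mg; case E : (bfs_norm Y g) => [N| |]// N0 _.
rewrite lte_fin in N0.
have Ni0 : (0 <= N^-1)%R by rewrite invr_ge0 ltW.
have mabs : nonneg_measurable (fun x => `|g x|).
  by split=> [|x]; [exact: measurable_abse|exact: abse_ge0].
have : \int[leb]_x `|f x * (N^-1%:E * g x)| <= associate_norm Y f.
  apply: ereal_sup_ubound; exists (fun x => N^-1%:E * g x); last by [].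
  split; first exact: measurable_funeM.
  rewrite /bfs_norm (_ : (fun x => _) = fun x => N^-1%:E * `|g x|).
    rewrite (fnormZ (bfs_rhoP Y) Ni0 mabs) -[bfs_rho Y _]/(bfs_norm Y g) E.
    by rewrite -EFinM mulVf// gt_eqF.
  by apply/funext => x; rewrite abseM gee0_abs ?lee_fin.
rewrite (_ : \int[leb]_x _ = N^-1%:E * \int[leb]_x `|f x * g x|).
  by rewrite lee_pdivrMl// muleC.
rewrite -ge0_integralZl_EFin; last 4 first.
- exact: measurableT.
- by move=> x _; exact: abse_ge0.
- by apply: measurable_abse; exact: emeasurable_funM.
- exact: Ni0.
by apply: eq_integral => x _; rewrite muleCA abseM gee0_abs ?lee_fin.
Qed.

End holder_associate.

Section norm_averages.
Local Open Scope ereal_scope.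
Context (R : realType) (n : nat).
Local Notation Rn := (Rn R n).
Local Notation leb := (@leb R n).
Implicit Types (Q : cube R n) (f g : Rn -> \bar R).

Lemma dilationE r f : dilation r f = f \o affine 0 r.
Proof. by apply/funext => x; rewrite /dilation /= /affine add0r. Qed.

Lemma measurable_dilation r f : (0 < r)%R -> measurable_fun setT f ->
  measurable_fun setT (dilation r f).
Proof.
move=> r0 mf; rewrite dilationE; apply: measurableT_comp; first exact: mf.
exact: measurable_affine.
Qed.

Lemma integral_dilation r f : (0 < r)%R -> measurable_fun setT f ->
  (forall x, 0 <= f x) ->
  \int[leb]_x dilation r f x = (r ^- n.+1)%:E * \int[leb]_x f x.
Proof. by move=> r0 mf f0; rewrite dilationE; exact: ge0_integral_affine. Qed.

Lemma measurable_restr Q f : measurable_fun setT f ->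
  measurable_fun setT (fun x => f x * (\1_(cset Q) x)%:E).
Proof.
move=> mf; apply: emeasurable_funM; first exact: mf.
by apply/measurable_EFinP; apply: measurable_indic; exact: measurable_cset.
Qed.

Lemma integral_restr Q f :
  \int[leb]_x (f x * (\1_(cset Q) x)%:E) = \int[leb]_(x in cset Q) f x.
Proof.
rewrite [RHS]integral_mkcond; apply: eq_integral => x _.
by rewrite epatch_indic.
Qed.

Hypothesis unit_gt0 : 0 < leb (cset (unit_cube R n)).

(** Dilation by [side Q] moves the restriction of [f] to a cube of side 1. This puts averages in the
    form of the integrals to which Hölder's inequality for [Y] applies. *)
Lemma average_dilation Q f : measurable_fun setT f -> (forall x, 0 <= f x) ->
  average Q f = (leb (cset (unit_cube R n)))^-1 *
    \int[leb]_x dilation (side Q) (fun x => f x * (\1_(cset Q) x)%:E) x.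
Proof.
move=> mf f0; have s0 := side_gt0 Q.
rewrite integral_dilation; last 3 first.
- exact: s0.
- exact: measurable_restr.
- by move=> x; rewrite mule_ge0// lee_fin.
rewrite integral_restr /average leb_cset.
have := unit_cube_fin_num R n; move: unit_gt0.
case: (leb (cset _)) => // c; rewrite lte_fin => c0 _.
have sn : (side Q ^+ n.+1 != 0)%R by rewrite gt_eqF// exprn_gt0.
rewrite muleA -EFinM !inver mulf_eq0 (negbTE sn) (gt_eqF c0)/= -EFinM.
by rewrite invfM mulrC.
Qed.

Variables (Y : banach_function_space R n) (f v : Rn -> R).
Hypotheses (mf : measurable_fun setT f) (f0 : forall x, (0 <= f x)%R).
Hypotheses (mv : measurable_fun setT v) (v0 : {ae leb, forall x, (0 < v x)%R}).

Let mV : measurable_fun setT (fun x => ((v x)^-1)%:E).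
Proof.
apply/measurable_EFinP.
(* Squaring gives a nonnegative base, for which inversion is a real power. Where [v x = 0], both
   sides are 0 by convention. *)
rewrite (_ : (fun x => _) = fun x => (v x * (v x ^+ 2) `^ (- 1))%R).
  apply: measurable_funM; first exact: mv.
  apply: (measurableT_comp (measurable_powR _)); apply: measurable_funX.
  exact: mv.
apply/funext => x; rewrite powR_inv1 ?sqr_ge0// expr2 invfM mulrA.
by have [->|vx0] := eqVneq (v x) 0%R; rewrite ?invr0 ?mulr0// divff ?mul1r.
Qed.

(** If the norm were zero, the dilated function would vanish almost everywhere, and so would the
    average of [|1/v|] over [Q]; but [1/v] is positive almost everywhere and [Q] has positive
    measure. *)
Lemma norm_average_inv_gt0 Q :
  0 < norm_average (bfs_norm Y) Q (fun x => ((v x)^-1)%:E).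
Proof.
set G := dilation (side Q) (fun x => ((v x)^-1)%:E * (\1_(cset Q) x)%:E).
have mG : measurable_fun setT G.
  by apply: measurable_dilation; [exact: side_gt0|exact: measurable_restr].
have mabs : nonneg_measurable (fun x => `|G x|).
  by split=> [|x]; [exact: measurable_abse|exact: abse_ge0].
rewrite /norm_average -/G lt_neqAle /bfs_norm (fnorm_ge0 (bfs_rhoP Y))// andbT.
rewrite eq_sym; apply/eqP => /(fnorm_eq0 (bfs_rhoP Y) mabs) G0.
have mA : measurable_fun setT (fun x => `|((v x)^-1)%:E|).
  exact: measurable_abse.
have : average Q (fun x => `|((v x)^-1)%:E|) = 0.
  rewrite average_dilation; [|exact: mA|by move=> x; exact: abse_ge0].
  rewrite (_ : \int[leb]_x _ = \int[leb]_x `|G x|); last first.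
    apply: eq_integral => x _; rewrite /G /dilation abseM.
    by congr (_ * _); rewrite gee0_abs ?lee_fin.
  rewrite (@ae_eq_integral _ _ _ leb setT (cst 0)); last 4 first.
  - exact: measurableT.
  - exact: mabs.1.
  - exact: measurable_cst.
  - by apply: filterS G0 => x ->.
  by rewrite integral0 mule0.
have Q0 := leb_cset_gt0 unit_gt0 Q; have Qf := leb_cset_fin_num Q.
apply/eqP; rewrite gt_eqF; [by []|apply: mule_gt0].
  rewrite inve_gt0; [exact: Q0|by rewrite gt_eqF|].
  by rewrite -ltey ltey_eq Qf.
apply: ae_pos_integral_gt0.
- exact: measurable_cset.
- exact: Q0.
- exact: mA.
- by move=> x; exact: abse_ge0.
- by apply: filterS v0 => x vx; rewrite lte_fin normr_gt0 invr_eq0 gt_eqF.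
Qed.

(** Almost everywhere [f = (fv) v^-1], and Hölder's inequality applies to the dilated factors. *)
Lemma average_le_norm_averages Q :
  norm_average (bfs_norm Y) Q (fun x => ((v x)^-1)%:E) \is a fin_num ->
  average Q (EFin \o f) <= (leb (cset (unit_cube R n)))^-1 *
    (norm_average (associate_norm Y) Q (fun x => (f x * v x)%:E) *
     norm_average (bfs_norm Y) Q (fun x => ((v x)^-1)%:E)).
Proof.
move=> Bfin; have B0 := norm_average_inv_gt0 Q.
have mef : measurable_fun setT (EFin \o f) by exact/measurable_EFinP.
have mfv : measurable_fun setT (fun x => (f x * v x)%:E).
  by apply/measurable_EFinP; apply: measurable_funM; [exact: mf|exact: mv].
have ef0 x : 0 <= (EFin \o f) x by rewrite lee_fin.
rewrite average_dilation; [|exact: mef|exact: ef0].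
apply: lee_wpmul2l; first by rewrite inve_ge0.
have s0 := side_gt0 Q.
apply: le_trans (holder_associate _ _ B0 Bfin); last 2 first.
- by apply: measurable_dilation; [exact: s0|exact: measurable_restr].
- by apply: measurable_dilation; [exact: s0|exact: measurable_restr].
(* The cancellation of [v] is known almost everywhere before dilation, so the dilation is undone on
   both sides before the integrands are compared. *)
pose h x := `|(f x * v x)%:E * (\1_(cset Q) x)%:E *
  (((v x)^-1)%:E * (\1_(cset Q) x)%:E)|.
have mh : measurable_fun setT h.
  by apply: measurable_abse; apply: emeasurable_funM; exact: measurable_restr.
rewrite -[leRHS]/(\int[leb]_x dilation (side Q) h x).
rewrite !integral_dilation; [|exact: s0|exact: mh|by move=> x; exact: abse_ge0|
  exact: s0|exact: measurable_restr|
  by move=> x; rewrite mule_ge0// lee_fin].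
apply: lee_wpmul2l; first by rewrite lee_fin invr_ge0 exprn_ge0// ltW.
rewrite (@ae_eq_integral _ _ _ leb setT h); [exact: lexx|exact: measurableT|
  exact: measurable_restr|exact: mh|].
apply: filterS v0 => x vx _; rewrite /h.
have [Qx|nQx] := pselect (cset Q x); last first.
  by rewrite indicE (memNset nQx) !mule0 abse0.
rewrite indicE (mem_set Qx) !mule1 -EFinM mulfK ?gt_eqF//.
by rewrite gee0_abs ?lee_fin.
Qed.

End norm_averages.

(** * The two-weight estimate *)

Section two_weight.
Local Open Scope ereal_scope.
Context (R : realType) (n : nat).
Variables (D : int -> set (cube R n)) (S : set (cube R n)).
Local Notation leb := (@leb R n).
Hypotheses (dD : dyadic_grid D) (sS : sparse D S).

(** The generation 0 of the grid covers the space by countably many cubes, all null by scaling. *)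
Lemma leb_setT_eq0 : leb (cset (unit_cube R n)) = 0 -> leb [set: Rn R n] = 0.
Proof.
move=> c0; have [Ds /(_ (Posz 0))[<- t0 _] _] := dD.
have cD : countable (D (Posz 0)).
  exact: countable_same_side (Ds (Posz 0)) t0.
apply/eqP; rewrite -measure_le0.
apply: le_trans (measure_bigcup_le_esum cD leb _) _.
  by move=> Q _; exact: measurable_cset.
by rewrite esum1// => Q _; have := leb_cset Q; rewrite c0 mule0; exact.
Qed.

Hypothesis unit_gt0 : 0 < leb (cset (unit_cube R n)).

(** Countability of [S] allows one null set to collect the failures of [w > 0] and the points that
    lie in no layer of some cube containing them. *)
Lemma sparse_exceptional_set (w : Rn R n -> R) :
  {ae leb, forall x, (0 < w x)%R} ->
  exists N : set (Rn R n), [/\ measurable N, leb N = 0 & forall x, ~ N x ->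
    (0 < w x)%R /\ forall Q, S Q -> ~ (\bigcap_k below S k Q) x].
Proof.
move=> [N [mN N0 wN]]; have cS := countable_sparse dD sS.
have mB (Q : cube R n) : measurable (\bigcap_k below S k Q).
  by apply: bigcapT_measurable => k; exact: measurable_below dD sS _ _.
pose B := \bigcup_(Q in S) \bigcap_k below S k Q.
have mBU : measurable B by apply: countable_bigcup_measurable.
have B0 : leb B = 0.
  apply/eqP; rewrite -measure_le0.
  apply: le_trans (measure_bigcup_le_esum cS leb _) _ => //.
  by rewrite esum1// => Q SQ; exact: (leb_bigcap_below dD sS SQ).
exists (N `|` B); split; first exact: measurableU.
  by rewrite measureU0.
move=> x /not_orP[Nx Bx]; split.
  by apply: contra_notP Nx => wx; apply: wN.
by move=> Q SQ Qx; apply: Bx; exists Q.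
Qed.

Lemma associate_norm_ge0 (Y : banach_function_space R n) f :
  0 <= associate_norm Y f.
Proof.
apply: (@le_trans _ _ (\int[leb]_x `|f x * cst 0 x|)).
  by apply: integral_ge0 => x _; exact: abse_ge0.
apply: ereal_sup_ubound; exists (cst 0); last by [].
split; first exact: measurable_cst.
rewrite /bfs_norm (_ : bfs_rho Y _ = 0) ?lee01//.
apply/(fnorm_eq0 (bfs_rhoP Y)).
  split=> [|x]; last exact: abse_ge0.
  by apply: measurable_abse; exact: measurable_cst.
by apply: aeW => x; rewrite abse0.
Qed.

(** The zeroth layers are disjoint, and on that of [Q] the maximal function is at least the norm
    average over [Q]. The integrals are compared through simple functions, so measurability of the
    maximal function is not at issue. *)
Lemma esum_layer0_le_maximal (norm : (Rn R n -> \bar R) -> \bar R) f (p : R) :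
  (0 <= p)%R -> (forall g, 0 <= norm g) ->
  \esum_(Q in S) (norm_average norm Q f `^ p * leb (layer S 0 Q)) <=
  \int[leb]_x (maximal norm f x) `^ p.
Proof.
move=> p0 norm0; have cS := countable_sparse dD sS.
have mI Q :
    measurable_fun setT (fun x : Rn R n => (\1_(layer S 0 Q) x)%:E : \bar R).
  apply/measurable_EFinP; apply: measurable_indic.
  exact: measurable_layer dD sS _ _.
pose h Q x := norm_average norm Q f `^ p * (\1_(layer S 0 Q) x)%:E.
have h0 Q x : 0 <= h Q x by rewrite mule_ge0 ?poweR_ge0 ?lee_fin.
rewrite (_ : esum _ _ = \esum_(Q in S) \int[leb]_x h Q x); last first.
  apply: eq_esum => Q SQ; rewrite ge0_integralZl; last 4 first.
  - exact: measurableT.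
  - exact: mI.
  - by move=> x _; rewrite lee_fin.
  - exact: poweR_ge0.
  rewrite integral_indic ?setIT//; exact: measurable_layer dD sS _ _.
rewrite -integral_esum; [|exact: cS| |exact: h0]; last first.
  by move=> Q _; apply: emeasurable_funM; [exact: measurable_cst|exact: mI].
apply: ge0_le_lower_integral => x; first exact: esum_ge0.
have [[Q [SQ [Qx _] ->]]|[_ ->]] := esum_trivIset x
  (fun Q => poweR_ge0 (norm_average norm Q f) p) (trivIset_layer (k := 0%N) dD sS);
  last exact: poweR_ge0.
have le_max : norm_average norm Q f <= maximal norm f x.
  by apply: ereal_sup_ubound; exists Q.
apply: gt0_ler_poweR; rewrite ?in_itv/= ?leey ?andbT ?norm0//.
by apply: le_trans le_max; exact: norm0.
Qed.

Variables (p q K : R) (Y : banach_function_space R n) (w v : Rn R n -> R).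
Hypotheses (pq : (0 < p < q)%R) (K0 : (0 < K)%R).
Hypotheses (mw : measurable_fun setT w) (w0 : {ae leb, forall x, (0 < w x)%R}).
Hypotheses (mv : measurable_fun setT v) (v0 : {ae leb, forall x, (0 < v x)%R}).
Hypothesis wvK : forall Q, S Q ->
  Lp_average q Q (EFin \o w) *
  norm_average (bfs_norm Y) Q (fun x => ((v x)^-1)%:E) <= K%:E.

Let p0 : (0 < p)%R. Proof. by case/andP: pq. Qed.
Let q0 : (0 < q)%R. Proof. by case/andP: pq => ?; exact: lt_trans. Qed.

Lemma Lp_average_gt0 Q : 0 < Lp_average q Q (EFin \o w).
Proof.
have Q0 := leb_cset_gt0 unit_gt0 Q; have Qf := leb_cset_fin_num Q.
apply: poweR_gt0; apply: mule_gt0.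
  rewrite inve_gt0; [exact: Q0|by rewrite gt_eqF|].
  by rewrite -ltey ltey_eq Qf.
apply: ae_pos_integral_gt0.
- exact: measurable_cset.
- exact: Q0.
- apply/measurable_EFinP; apply: (measurableT_comp (measurable_powR q)).
  by apply: measurableT_comp; [exact: normr_measurable|exact: mw].
- by move=> x; exact: poweR_ge0.
- by apply: filterS w0 => x wx; rewrite poweR_gt0// lte_fin normr_gt0 gt_eqF.
Qed.

(** Both factors are positive, so an infinite one would make the product infinite, against [wvK]. *)
Lemma two_weight_fin_num Q : S Q ->
  Lp_average q Q (EFin \o w) \is a fin_num /\
  norm_average (bfs_norm Y) Q (fun x => ((v x)^-1)%:E) \is a fin_num.
Proof.
move=> SQ; have := Lp_average_gt0 Q.
have := norm_average_inv_gt0 unit_gt0 Y mv v0 Q.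
have := wvK SQ.
case: (Lp_average _ _ _) => [W| |]//; case: (norm_average _ _ _) => [B| |]//.
- by move=> + _ W0; rewrite gt0_muley// leye_eq.
- by move=> + B0 _; rewrite gt0_mulye// leye_eq.
Qed.

Local Notation beta := (2^-1 `^ (1 - p / q))%R.
Local Notation th := (beta `^ (2 * p)^-1)%R.
Local Notation c := (fine (leb (cset (unit_cube R n)))).

(** The factor 4 combines the 2 of [integral_depth_weight_le] with the 2 lost in replacing [Q] by
    its zeroth layer; [(K / c)^p] comes from Hölder's inequality and the weight condition. *)
Lemma integral_cube_le Q (f : Rn R n -> R) : S Q ->
  measurable_fun setT f -> (forall x, (0 <= f x)%R) ->
  average Q (EFin \o f) `^ p *
    \int[leb]_x ((`|w x| `^ p)%:E * depth_weight S p th Q x) <=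
  (4 / (1 - beta `^ 2^-1) * (K / c) `^ p)%:E *
  (norm_average (associate_norm Y) Q (fun x => (f x * v x)%:E) `^ p *
   leb (layer S 0 Q)).
Proof.
move=> SQ mf f0; have [Wf Bf] := two_weight_fin_num SQ.
have := average_le_norm_averages unit_gt0 mf f0 mv v0 Bf.
have A0 : 0 <= norm_average (associate_norm Y) Q (fun x => (f x * v x)%:E).
  exact: associate_norm_ge0.
have a0 : 0 <= average Q (EFin \o f).
  rewrite /average mule_ge0 ?inve_ge0 ?integral_ge0// => x _.
  by rewrite lee_fin.
move: A0 a0; set A := norm_average (associate_norm Y) _ _; set a := average _ _.
move=> A0 a0 aAB.
have W0 := Lp_average_gt0 Q.
have B0 := norm_average_inv_gt0 unit_gt0 Y mv v0 Q.
have := wvK SQ; move: aAB Bf B0; set B := norm_average _ _ _.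
move=> aAB Bf B0.
have [W WE] : exists W, Lp_average q Q (EFin \o w) = W%:E.
  by exists (fine (Lp_average q Q (EFin \o w))); rewrite fineK.
rewrite WE in W0 *; rewrite lte_fin in W0.
move=> WBK.
have /andP[g0 g1] : (0 < beta `^ 2^-1 < 1)%R.
  by apply: powR_gt0_lt1; [exact: beta01 pq|rewrite invr_gt0].
have uf := unit_cube_fin_num R n.
have c0 : (0 < c)%R by rewrite fine_gt0// unit_gt0 ltey_eq uf.
(* Hölder's inequality gives [a <= A B / c], and the weight condition is [W B <= K]. *)
have aWA : a * W%:E <= (K / c)%:E * A.
  apply: le_trans (lee_wpmul2r _ aAB) _; first by rewrite lee_fin ltW.
  rewrite -(fineK uf) inver gt_eqF// mulrC EFinM -!muleA.
  apply: lee_wpmul2l; first by rewrite lee_fin invr_ge0 ltW.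
  rewrite [leRHS]muleC; apply: lee_wpmul2l => //.
  by rewrite muleC.
have Lf := leb_cset_le_layer0 dD sS SQ.
apply: le_trans (lee_wpmul2l (poweR_ge0 _ _)
  (integral_depth_weight_le dD sS unit_gt0 pq mw SQ W0 WE)) _.
set g := (beta `^ _)%R in g0 g1 *.
have g10 : (0 < 1 - g)%R by rewrite subr_gt0.
clearbody g.
apply: (@le_trans _ _ ((2 / (1 - g))%:E * ((a * W%:E) `^ p *
    (2%:E * leb (layer S 0 Q))))).
  rewrite poweRM//; last by rewrite lee_fin ltW.
  rewrite poweR_EFin.
  rewrite (_ : (2 * W `^ p / (1 - g))%:E = (2 / (1 - g))%:E * (W `^ p)%:E); last first.
    by rewrite -EFinM mulrAC.
  rewrite -!muleA muleCA.
  apply: lee_wpmul2l; first by rewrite lee_fin divr_ge0// ltW.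
  apply: lee_wpmul2l; first exact: poweR_ge0.
  apply: lee_wpmul2l; first by rewrite lee_fin powR_ge0.
  exact: Lf.
have L0 : 0 <= leb (layer S 0 Q) by [].
have -> : (4 / (1 - g) * (K / c) `^ p)%:E * (A `^ p * leb (layer S 0 Q)) =
  (2 / (1 - g))%:E * (((K / c)%:E * A) `^ p * (2%:E * leb (layer S 0 Q))).
  rewrite poweRM; [|by rewrite lee_fin divr_ge0// ltW|exact: A0].
  rewrite poweR_EFin; move: ((K / c) `^ p)%R (A `^ p) (leb (layer S 0 Q)) => k X L.
  rewrite (muleCA (k%:E * X)) !muleA -!EFinM; congr (_%:E * _ * _).
  by ring.
apply: lee_wpmul2l; first by rewrite lee_fin divr_ge0// ltW.
apply: lee_wpmul2r; first by rewrite mule_ge0.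
apply: gt0_ler_poweR; rewrite ?in_itv/= ?leey ?andbT ?(ltW p0)//.
  by rewrite mule_ge0// lee_fin ltW.
by rewrite mule_ge0// lee_fin divr_ge0// ltW.
Qed.

(** The first factor is the price of the pointwise bound [sparse_sum_le]; the rest is the constant
    of [integral_cube_le]. *)
Definition two_weight_const : R :=
  (((1 - th)^-1) `^ p * (4 / (1 - beta `^ 2^-1) * (K / c) `^ p))%R.

Lemma two_weight_const_gt0 : (0 < two_weight_const)%R.
Proof.
have b01 := beta01 pq.
have /andP[_ t1] : (0 < th < 1)%R.
  by apply: powR_gt0_lt1 => //; rewrite invr_gt0 mulr_gt0.
have /andP[_ g1] : (0 < beta `^ 2^-1 < 1)%R.
  by apply: powR_gt0_lt1 => //; rewrite invr_gt0.
have c0 : (0 < c)%R by rewrite fine_gt0// unit_gt0 ltey_eq unit_cube_fin_num.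
rewrite /two_weight_const; apply: mulr_gt0.
  by rewrite powR_gt0// invr_gt0 subr_gt0.
apply: mulr_gt0; first by rewrite divr_gt0// subr_gt0.
by rewrite powR_gt0// divr_gt0.
Qed.

Lemma sparse_two_weight (f : Rn R n -> R) :
  measurable_fun setT f -> (forall x, (0 <= f x)%R) ->
  \int[leb]_x (sparse_op S f x * (w x)%:E) `^ p <=
  two_weight_const%:E *
  \int[leb]_x (maximal (associate_norm Y) (fun y => (f y * v y)%:E) x) `^ p.
Proof.
move=> mf f0; have cS := countable_sparse dD sS.
have th01 : (0 < th < 1)%R.
  by apply: powR_gt0_lt1; [exact: beta01 pq|rewrite invr_gt0 mulr_gt0].
pose a Q := average Q (EFin \o f).
have a0 Q : 0 <= a Q.
  rewrite /a /average mule_ge0 ?inve_ge0 ?integral_ge0// => x _.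
  by rewrite lee_fin.
pose H Q x := (`|w x| `^ p)%:E * depth_weight S p th Q x.
have mpow : measurable_fun setT (fun x : Rn R n => (`|w x| `^ p)%:E).
  apply/measurable_EFinP; apply: (measurableT_comp (measurable_powR p)).
  by apply: measurableT_comp; [exact: normr_measurable|exact: mw].
have mH Q : measurable_fun setT (H Q).
  apply: emeasurable_funM; first exact: mpow.
  exact: measurable_depth_weight dD sS _ _ _.
have H0 Q x : 0 <= H Q x.
  apply: mule_ge0; first by rewrite lee_fin powR_ge0.
  exact: depth_weight_ge0.
pose k1 := (((1 - th)^-1) `^ p)%R.
have k10 : (0 <= k1)%R by exact: powR_ge0.
pose G x := \esum_(Q in S) (a Q `^ p * H Q x).
have aH0 Q x : 0 <= a Q `^ p * H Q x.
  by apply: mule_ge0; [exact: poweR_ge0|exact: H0].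
have maH Q : measurable_fun setT (fun x => a Q `^ p * H Q x).
  by apply: emeasurable_funM; [exact: measurable_cst|exact: mH].
have mG : measurable_fun setT G by apply: measurable_fun_esum.
have [N [mN N0 Nx]] := sparse_exceptional_set w0.
(* Off [N], the pointwise bound on the sparse operator is multiplied by [w^p], which is then moved
   inside the sum over [S]. *)
apply: (@le_trans _ _ (\int[leb]_x (k1%:E * G x))).
  apply: (le_lower_integral_null mN N0).
  - exact: measurable_funeM.
  - by move=> x; exact: poweR_ge0.
  - move=> x; apply: mule_ge0; first by rewrite lee_fin.
    by apply: esum_ge0 => Q _; exact: aH0.
  move=> x /Nx[wx nx].
  have T0 : 0 <= sparse_op S f x.
    by apply: esum_ge0 => Q _; apply: mule_ge0; [exact: a0|rewrite lee_fin].
  rewrite poweRM ?lee_fin ?(ltW wx)// poweR_EFin.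
  apply: (le_trans (lee_wpmul2r _ (sparse_sum_le dD sS p0 th01 a0 nx))).
    by rewrite lee_fin powR_ge0.
  rewrite -muleA; apply: lee_wpmul2l; first by rewrite lee_fin.
  rewrite muleC -ge0_esumZl ?powR_ge0//; last first.
    by move=> Q; apply: mule_ge0; [exact: poweR_ge0|exact: depth_weight_ge0].
  by apply: le_esum => Q _; rewrite muleCA /H gtr0_norm.
rewrite ge0_integralZl_EFin; last 4 first.
- exact: measurableT.
- by move=> x _; apply: esum_ge0 => Q _; exact: aH0.
- exact: mG.
- exact: k10.
rewrite /two_weight_const EFinM -muleA.
apply: lee_wpmul2l; first by rewrite lee_fin.
rewrite integral_esum; [|exact: cS|by move=> Q _; exact: maH|exact: aH0].
have k20 : (0 <= 4 / (1 - beta `^ 2^-1) * (K / c) `^ p)%R.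
  have /andP[_ g1] : (0 < beta `^ 2^-1 < 1)%R.
    by apply: powR_gt0_lt1; [exact: beta01 pq|rewrite invr_gt0].
  apply: mulr_ge0; last exact: powR_ge0.
  by rewrite divr_ge0// subr_ge0 ltW.
have nA0 := @associate_norm_ge0 Y.
apply: le_trans (lee_wpmul2l _ (esum_layer0_le_maximal
  (fun y => (f y * v y)%:E) (ltW p0) nA0)); last by rewrite lee_fin.
rewrite -ge0_esumZl; [|exact: cS| |exact: k20]; last first.
  by move=> Q; apply: mule_ge0; [exact: poweR_ge0|].
apply: le_esum => Q SQ.
rewrite ge0_integralZl; [|exact: measurableT|exact: mH|
  by move=> x _; exact: H0|exact: poweR_ge0].
exact: integral_cube_le.
Qed.

End two_weight.

Theorem theorem1p1 (R : realType) (n : nat) (p : R)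
    (Y : banach_function_space R n)
    (D : int -> set (cube R n)) (S : set (cube R n)) (w v : Rn R n -> R) :
  1 < p ->
  dyadic_grid D -> sparse D S ->
  weight w -> weight v ->
  (exists q K : R, p < q /\
    forall Q, S Q ->
      (Lp_average q Q (EFin \o w) *
       norm_average (bfs_norm Y) Q (fun x => ((v x)^-1)%:E) <= K%:E)%E) ->
  exists C : R, 0 < C /\
    forall f : Rn R n -> R,
      loc_integrable f -> (forall x, 0 <= f x) ->
      (\int[@leb R n]_y (sparse_op S f y * (w y)%:E) `^ p <=
       (C `^ p)%:E *
       \int[@leb R n]_y (maximal (associate_norm Y)
                           (fun x => (f x * v x)%:E) y) `^ p)%E.
Proof.
move=> p1 dD sS [[mw _] w0] [[mv _] v0] [q [K [pq wvK]]].
have p0 : 0 < p by apply: lt_trans p1.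
(* Unit cubes have measure 1, but their measure [c] enters only the constant; if
   [c] were 0, all integrals would vanish, so positivity need not be proved. *)
have [c0|c0] := eqVneq (leb (cset (unit_cube R n))) 0%E.
  exists 1; split => // f _ _.
  apply: (@le_trans _ _ (\int[@leb R n]_y cst 0%E y)%E).
    apply: (le_lower_integral_null measurableT (leb_setT_eq0 dD c0)).
    - exact: measurable_cst.
    - by move=> x; exact: poweR_ge0.
    - by move=> x.
    - by move=> x /(_ I).
  rewrite integral0 mule_ge0 ?lee_fin ?powR_ge0// integral_ge0// => x _.
  exact: poweR_ge0.
have {}c0 : (0 < leb (cset (unit_cube R n)))%E.
  by rewrite lt_neqAle eq_sym c0 measure_ge0.
(* Enlarging [K] keeps the weight condition and makes the final constant positive. *)
have K0 : 0 < Num.max K 1 by rewrite lt_max ltr01 orbT.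
have wvK1 Q : S Q -> (Lp_average q Q (EFin \o w) *
    norm_average (bfs_norm Y) Q (fun x => ((v x)^-1)%:E) <= (Num.max K 1)%:E)%E.
  by move=> SQ; apply: le_trans (wvK Q SQ) _; rewrite lee_fin le_max lexx.
have pq0 : 0 < p < q by rewrite p0.
have C0 := two_weight_const_gt0 c0 pq0 K0.
exists (two_weight_const n p q (Num.max K 1) `^ p^-1); split.
  by rewrite powR_gt0.
move=> f [mf _] f0.
rewrite -powRrM mulVf ?gt_eqF// powRr1 ?(ltW C0)//.
exact: (sparse_two_weight dD sS c0 pq0 K0 mw w0 mv v0 wvK1 mf f0).
Qed.
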